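(* Let $h$ be a quasi-homogeneous polynomial of degree $\delta$ on $\mathbb C^2$ (with respect to $R=p_1x\partial_x+p_2y\partial_y$) with an isolated singularity at $0$, let $S=\{h=0\}$, and let $X_0=\delta^{-1}(h_y\partial_x-h_x\partial_y)$. Let $a_1=1,a_2,\dots,a_\mu$ be monomials whose classes form a basis of the vector space $\mathcal O_2/J_0$, where $J_0=(h_x,h_y)$. Let $X=X_0+\cdots$ be a perturbation of $X_0$ with fixed separatrices. Then there exist $(d_1,\dots,d_\mu)\in\mathbb C[[h]]^\mu$ and a formal diffeomorphism $\Phi$ which orbitally conjugates $X$ to the formal vector field $$X_0+\sum_{i=1}^{\mu}d_i(h)\,a_iR .$$ Moreover, $\Phi$ can be required to be fibered with respect to $R$, that is, to be the exponential of a vector field collinear to $R$ (i.e. of the form $\Phi=\exp(bR)$ with $b$ a formal power series).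
   Context: $p_1,p_2$ are relatively prime positive integers. $h$ is quasi-homogeneous of degree $\delta$ if $R(h)=\delta h$; a vector field $Z$ is quasi-homogeneous of degree $k$ if $[R,Z]=kZ$. The field $X_0$ is quasi-homogeneous of degree $\delta_0=\delta-p_1-p_2$. $\mathcal O_2=\mathbb C\{x,y\}$, $\widehat{\mathcal O}_2=\mathbb C[[x,y]]$. A perturbation of $X_0$ with fixed separatrices is a (formal or analytic) vector field $X=X_0+\cdots$ such that all quasi-homogeneous components of $X-X_0$ have degree $>\delta_0$ and $X$ is tangent to $S$, i.e. $X(h)\in(h)$. $\Phi$ orbitally conjugates $X$ to $Y$ if there is a formal unit $u\in\widehat{\mathcal O}_2$, $u(0)\neq0$, with $\Phi^*X=uY$, where $\Phi^*X=(D\Phi)^{-1}\cdot(X\circ\Phi)$. *)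

(* Defs.v *)
From HB Require Import structures.
From mathcomp Require Import all_boot all_order all_algebra.
From mathcomp Require Import boolp classical_sets filter topology normedtype.
From mathcomp Require Import sequences.
From mathcomp Require Import complex.

Set Implicit Arguments.
Unset Strict Implicit.
Unset Printing Implicit Defensive.

Import Order.TTheory GRing.Theory Num.Theory numFieldNormedType.Exports.

Local Open Scope classical_set_scope.
Local Open Scope ring_scope.

(* K[[x, y]]: [f i j] is the coefficient of x^i y^j. *)
Record fps2 (K : Type) := FPS2 { fps2_coef :> nat -> nat -> K }.

HB.instance Definition _ (K : Type) := gen_eqMixin (fps2 K).
HB.instance Definition _ (K : Type) := gen_choiceMixin (fps2 K).

Section Ring.
Variable K : fieldType.
Implicit Types (f g : fps2 K) (P Q : {poly {poly K}}).

Lemma fps2P f g : (forall i j, f i j = g i j) <-> f = g.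
Proof.
split=> [|-> //]; case: f g => [f] [g] /= fg.
by congr FPS2; apply/funext => i; apply/funext => j.
Qed.

Definition fps2_zero : fps2 K := FPS2 (fun _ _ => 0).
Definition fps2_opp f : fps2 K := FPS2 (fun i j => - f i j).
Definition fps2_add f g : fps2 K := FPS2 (fun i j => f i j + g i j).
Definition fps2_one : fps2 K := FPS2 (fun i j => ((i == 0) && (j == 0))%:R).
Definition fps2_mul f g : fps2 K :=
  FPS2 (fun i j => \sum_(k < i.+1) \sum_(l < j.+1) f k l * g (i - k)%N (j - l)%N).
Definition fps2_scale (c : K) f : fps2 K := FPS2 (fun i j => c * f i j).

Let addA : associative fps2_add.
Proof. by move=> f g h; apply/fps2P => i j /=; rewrite addrA. Qed.
Let addC : commutative fps2_add.
Proof. by move=> f g; apply/fps2P => i j /=; rewrite addrC. Qed.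
Let add0 : left_id fps2_zero fps2_add.
Proof. by move=> f; apply/fps2P => i j /=; rewrite add0r. Qed.
Let addN : left_inverse fps2_zero fps2_opp fps2_add.
Proof. by move=> f; apply/fps2P => i j /=; rewrite addNr. Qed.

HB.instance Definition _ := GRing.isZmodule.Build (fps2 K) addA addC add0 addN.

Definition fps2_of_poly P : fps2 K := FPS2 (fun i j => P`_i`_j).

Let agree n P f := forall i j, (i < n)%N -> (j < n)%N -> P`_i`_j = f i j.
Let tr n f : {poly {poly K}} := \poly_(i < n) \poly_(j < n) f i j.

Let agree_tr n f : agree n (tr n f) f.
Proof. by move=> i j ltin ltjn; rewrite coef_poly ltin coef_poly ltjn. Qed.

Let agreeM n P Q f g :
  agree n P f -> agree n Q g -> agree n (P * Q) (fps2_mul f g).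
Proof.
move=> Pf Qg i j ltin ltjn; rewrite coefM coef_sum /=.
apply: eq_bigr => -[k /= ki] _; rewrite coefM.
apply: eq_bigr => -[l /= lj] _; rewrite Pf ?Qg //.
- exact: leq_ltn_trans (leq_subr _ _) ltin.
- exact: leq_ltn_trans (leq_subr _ _) ltjn.
- exact: leq_trans ki ltin.
- exact: leq_trans lj ltjn.
Qed.

Let agree1 n : agree n 1 fps2_one.
Proof.
move=> i j _ _; rewrite coef1 /=; case: (i == 0%N) => /=; last by rewrite coef0.
by rewrite coef1.
Qed.

Let agreeD n P Q f g : agree n P f -> agree n Q g -> agree n (P + Q) (f + g).
Proof. by move=> Pf Qg i j ltin ltjn; rewrite !coefD Pf ?Qg. Qed.

Let agree_eq f g :
  (forall n, exists P, agree n P f /\ agree n P g) -> f = g.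
Proof.
move=> fg; apply/fps2P => i j; have [P [Pf Pg]] := fg (maxn i j).+1.
by rewrite -Pf ?Pg ?ltnS ?leq_maxl ?leq_maxr.
Qed.

Let mulA : associative fps2_mul.
Proof.
move=> f g h; apply: agree_eq => n; exists (tr n f * tr n g * tr n h).
by split; [rewrite -mulrA|]; repeat first [apply: agreeM | apply: agree_tr].
Qed.
Let mulC : commutative fps2_mul.
Proof.
move=> f g; apply: agree_eq => n; exists (tr n f * tr n g).
by split; [|rewrite mulrC]; repeat first [apply: agreeM | apply: agree_tr].
Qed.
Let mul1 : left_id fps2_one fps2_mul.
Proof.
move=> f; apply: agree_eq => n; exists (1 * tr n f).
split; last by rewrite mul1r.
by apply: agreeM; [apply: agree1 | apply: agree_tr].
Qed.
Let mulDl : left_distributive fps2_mul +%R.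
Proof.
move=> f g h; apply: agree_eq => n; exists ((tr n f + tr n g) * tr n h).
by split; [|rewrite mulrDl];
  repeat first [apply: agreeM | apply: agreeD | apply: agree_tr].
Qed.
Let one_neq0 : fps2_one != 0.
Proof. by apply/eqP => /fps2P /(_ 0%N 0%N) /= /eqP; rewrite oner_eq0. Qed.

HB.instance Definition _ :=
  GRing.Zmodule_isComNzRing.Build (fps2 K) mulA mulC mul1 mulDl one_neq0.

Let scaleA a b f : fps2_scale a (fps2_scale b f) = fps2_scale (a * b) f.
Proof. by apply/fps2P => i j /=; rewrite mulrA. Qed.
Let scale1 : left_id 1 fps2_scale.
Proof. by move=> f; apply/fps2P => i j /=; rewrite mul1r. Qed.
Let scaleDr : right_distributive fps2_scale +%R.
Proof. by move=> a f g; apply/fps2P => i j /=; rewrite mulrDr. Qed.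
Let scaleDl f : {morph fps2_scale^~ f : a b / a + b}.
Proof. by move=> a b; apply/fps2P => i j /=; rewrite mulrDl. Qed.

HB.instance Definition _ :=
  GRing.Zmodule_isLmodule.Build K (fps2 K) scaleA scale1 scaleDr scaleDl.

Let scaleAl (a : K) f g : a *: (f * g) = a *: f * g.
Proof.
apply/fps2P => i j /=; rewrite mulr_sumr; apply: eq_bigr => k _.
by rewrite mulr_sumr; apply: eq_bigr => l _; rewrite mulrA.
Qed.

HB.instance Definition _ :=
  GRing.Lmodule_isLalgebra.Build K (fps2 K) scaleAl.
HB.instance Definition _ := GRing.Lalgebra_isComAlgebra.Build K (fps2 K).

Lemma fps2_coef0 i j : (0 : fps2 K) i j = 0. Proof. by []. Qed.
Lemma fps2_coef1 i j : (1 : fps2 K) i j = ((i == 0%N) && (j == 0%N))%:R.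
Proof. by []. Qed.
Lemma fps2_coefN f i j : (- f) i j = - f i j. Proof. by []. Qed.
Lemma fps2_coefD f g i j : (f + g) i j = f i j + g i j. Proof. by []. Qed.
Lemma fps2_coefB f g i j : (f - g) i j = f i j - g i j. Proof. by []. Qed.
Lemma fps2_coefZ (c : K) f i j : (c *: f) i j = c * f i j. Proof. by []. Qed.
Lemma fps2_coefM f g i j :
  (f * g) i j = \sum_(k < i.+1) \sum_(l < j.+1) f k l * g (i - k)%N (j - l)%N.
Proof. by []. Qed.
Lemma fps2_coef_sum I (r : seq I) (D : pred I) (F : I -> fps2 K) i j :
  (\sum_(k <- r | D k) F k) i j = \sum_(k <- r | D k) F k i j.
Proof. by elim/big_rec2: _ => // k y1 y2 _ <-. Qed.

Let ord_ge n f := forall i j, (i + j < n)%N -> f i j = 0.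

Let ord_geM m n f g : ord_ge m f -> ord_ge n g -> ord_ge (m + n) (f * g).
Proof.
move=> fm gn i j ltij; rewrite fps2_coefM; apply: big1 => -[k /= ki] _.
apply: big1 => -[l /= lj] _; have [/fm->|mkl] := ltnP (k + l) m.
  by rewrite mul0r.
rewrite (gn (i - k)%N (j - l)%N) ?mulr0 //.
have lei : (k <= i)%N by rewrite -ltnS.
have lej : (l <= j)%N by rewrite -ltnS.
have E : (k + l + (i - k + (j - l)) = i + j)%N by rewrite addnACA !subnKC.
rewrite -(ltn_add2l (k + l)) E.
exact: leq_trans ltij (leq_add mkl (leqnn n)).
Qed.

Lemma fps2_coefX_small f n i j : f 0%N 0%N = 0 -> (i + j < n)%N -> (f ^+ n) i j = 0.
Proof.
move=> f0; move: i j; rewrite -/(ord_ge n (f ^+ n)).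
have f1 : ord_ge 1 f by move=> [|i] [|j].
elim: n => [//|n IHn]; rewrite exprS -add1n; exact: ord_geM.
Qed.

(* The inverse is the geometric series: with c = f(0,0) and g = 1 - f/c, which
   has no constant term, f^-1 = c^-1 (1 + g + g^2 + ...). *)
Definition fps2_unit : pred (fps2 K) := fun f => f 0%N 0%N != 0.
Definition fps2_inv f : fps2 K :=
  if f 0%N 0%N == 0 then f else
  FPS2 (fun i j => ((f 0%N 0%N)^-1 *:
    \sum_(n < (i + j).+1) (1 - (f 0%N 0%N)^-1 *: f) ^+ n) i j).

Let invE f i j : f 0%N 0%N != 0 ->
  fps2_inv f i j =
  (f 0%N 0%N)^-1 * (\sum_(n < (i + j).+1) (1 - (f 0%N 0%N)^-1 *: f) ^+ n) i j.
Proof. by rewrite /fps2_inv => /negPf->. Qed.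

Let mulVf : {in fps2_unit, left_inverse 1 fps2_inv *%R}.
Proof.
move=> f; rewrite unfold_in => f0; have := invE _ _ f0.
set c := f 0%N 0%N; set g := 1 - c^-1 *: f => fV.
have g0 : g 0%N 0%N = 0 by rewrite fps2_coefB fps2_coefZ fps2_coef1 mulVf ?subrr.
apply/fps2P => i j.
transitivity (((c^-1 *: \sum_(n < (i + j).+1) g ^+ n) * f) i j).
  rewrite !fps2_coefM; apply: eq_bigr => -[k /= ki] _.
  apply: eq_bigr => -[l /= lj] _; congr (_ * _).
  rewrite fV !fps2_coef_sum; congr (_ * _).
  rewrite [RHS](bigID (fun n : 'I__ => (n < (k + l).+1)%N)) /= [X in _ + X]big1.
    rewrite addr0 (big_ord_widen (i + j).+1 (fun n => (g ^+ n) k l)) //.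
    by rewrite ltnS leq_add.
  by move=> n; rewrite -leqNgt => kln; apply: fps2_coefX_small.
rewrite -scalerAl mulrC scalerAl.
have -> : c^-1 *: f = - (g - 1) by rewrite /g !opprB addrC subrK.
rewrite mulNr -subrX1 opprB fps2_coefB fps2_coefX_small ?subr0 //.
Qed.

Let unitP f g : g * f = 1 -> fps2_unit f.
Proof.
move=> /fps2P /(_ 0%N 0%N); rewrite fps2_coefM !big_ord1 fps2_coef1 /= => gf.
by apply/eqP => f0; move: gf => /eqP; rewrite f0 mulr0 eq_sym oner_eq0.
Qed.

Let inv_out : {in [predC fps2_unit], fps2_inv =1 id}.
Proof. by move=> f; rewrite inE /= /fps2_unit negbK /fps2_inv => ->. Qed.

HB.instance Definition _ :=
  GRing.ComNzRing_hasMulInverse.Build (fps2 K) mulVf unitP inv_out.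

Lemma fps2_unitE f : (f \is a GRing.unit) = (f 0%N 0%N != 0).
Proof. by []. Qed.

Definition fps2_mono (m : nat * nat) : fps2 K :=
  FPS2 (fun i j => ((i == m.1) && (j == m.2))%:R).

(* The coordinates: index 0 is x and index 1 is y, here and below. *)
Definition fps2_var (k : 'I_2) : fps2 K :=
  fps2_mono (if k == 0 then (1%N, 0%N) else (0%N, 1%N)).

Definition fps2_deriv (k : 'I_2) f : fps2 K :=
  if k == 0 then FPS2 (fun i j => f i.+1 j *+ i.+1)
  else FPS2 (fun i j => f i j.+1 *+ j.+1).

Lemma fps2_deriv_poly0 P : fps2_deriv 0 (fps2_of_poly P) = fps2_of_poly P^`().
Proof. by apply/fps2P => i j /=; rewrite coef_deriv coefMn. Qed.

Lemma fps2_deriv_poly1 P :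
  fps2_deriv 1 (fps2_of_poly P) = fps2_of_poly (map_poly deriv P).
Proof. by apply/fps2P => i j /=; rewrite coef_map_id0 ?deriv0 // coef_deriv. Qed.

(* Substitutions, meaningful when the substituted series have no constant term:
   the terms left out of the sums then do not contribute to the coefficient of
   x^i y^j. A series in one variable t is given by its coefficients. *)
Definition fps2_comp f (Phi : 'cV[fps2 K]_2) : fps2 K :=
  FPS2 (fun i j => \sum_(k < (i + j).+1) \sum_(l < (i + j).+1)
    f k l * (Phi 0 0 ^+ k * Phi 1 0 ^+ l) i j).
Definition fps2_comp1 (d : nat -> K) f : fps2 K :=
  FPS2 (fun i j => \sum_(k < (i + j).+1) d k * (f ^+ k) i j).

(* A formal vector field Z 0 0 * d/dx + Z 1 0 * d/dy is a column vector, and so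
   is a formal map. *)
Definition vf_act (Z : 'cV[fps2 K]_2) f : fps2 K :=
  \sum_(k < 2) Z k 0 * fps2_deriv k f.

Definition vf_bracket (Z W : 'cV[fps2 K]_2) : 'cV[fps2 K]_2 :=
  \col_k (vf_act Z (W k 0) - vf_act W (Z k 0)).

Definition jacobian (Phi : 'cV[fps2 K]_2) : 'M[fps2 K]_2 :=
  \matrix_(k, l) fps2_deriv l (Phi k 0).

Definition formal_diffeo (Phi : 'cV[fps2 K]_2) : Prop :=
  (forall k, Phi k 0 0%N 0%N = 0) /\ jacobian Phi \in unitmx.

Definition vf_pullback (Phi X : 'cV[fps2 K]_2) : 'cV[fps2 K]_2 :=
  invmx (jacobian Phi) *m \col_k fps2_comp (X k 0) Phi.

Definition orbitally_conjugates (Phi X Y : 'cV[fps2 K]_2) : Prop :=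
  exists u : fps2 K, u 0%N 0%N != 0 /\ vf_pullback Phi X = u *: Y.

Definition weight (p1 p2 : nat) (k : 'I_2) : nat := if k == 0 then p1 else p2.

Definition euler (p1 p2 : nat) : 'cV[fps2 K]_2 :=
  \col_k ((weight p1 p2 k)%:R *: fps2_var k).

Definition qh_series (p1 p2 delta : nat) f : Prop :=
  vf_act (euler p1 p2) f = delta%:R *: f.

Definition qh_field (p1 p2 : nat) (k : int) (Z : 'cV[fps2 K]_2) : Prop :=
  vf_bracket (euler p1 p2) Z = (k%:~R : K)%:A *: Z.

(* The quasi-homogeneous component of degree k: x^i y^j d/dx has degree
   p1 i + p2 j - p1 and x^i y^j d/dy has degree p1 i + p2 j - p2, see
   [qh_fieldP]. *)
Definition qh_component (p1 p2 : nat) (k : int) (Z : 'cV[fps2 K]_2) :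
    'cV[fps2 K]_2 :=
  \col_m FPS2 (fun i j =>
    if (p1 * i + p2 * j)%N%:Z - (weight p1 p2 m)%:Z == k then Z m 0 i j else 0).

Definition hamiltonian (delta : nat) (h : fps2 K) : 'cV[fps2 K]_2 :=
  \col_k (delta%:R^-1 *: (if k == 0 then fps2_deriv 1 h else - fps2_deriv 0 h)).

Definition perturbation (p1 p2 delta : nat) (h : fps2 K) (X : 'cV[fps2 K]_2) :
    Prop :=
  (forall k : int, k <= delta%:Z - p1%:Z - p2%:Z ->
     qh_component p1 p2 k (X - hamiltonian delta h) = 0) /\
  (exists g, vf_act X h = g * h).

End Ring.

Section Analytic.
Variable K : numFieldType.
Implicit Types (f : fps2 K) (h : {poly {poly K}}).

Lemma vf_act_eulerE p1 p2 f i j :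
  vf_act (euler K p1 p2) f i j = (p1 * i + p2 * j)%:R * f i j.
Proof.
have E (k : 'I_2) (w : K) g : (w *: fps2_var K k * g) i j =
    w * (if k == 0 then (if i is i'.+1 then g i' j else 0)
         else (if j is j'.+1 then g i j' else 0)).
  rewrite -scalerAl fps2_coefZ; congr (_ * _); rewrite fps2_coefM /=.
  case: (k == 0) => /=.
    case: i => [|i]; first by rewrite big_ord1 big1 // => l _; rewrite mul0r.
    rewrite (bigD1 1) //= (bigD1 0) //= mul1r subn1 subn0 big1 ?addr0; last first.
      by move=> l; rewrite -val_eqE /= => /negPf->; rewrite mul0r.
    rewrite big1 ?addr0 // => m m1; apply: big1 => l _.
    suff -> : (m == 1 :> nat) = false by rewrite mul0r.
    by apply/negbTE; rewrite -val_eqE in m1.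
  case: j => [|j]; first by rewrite big1 // => l _; rewrite big_ord1 andbF mul0r.
  rewrite (bigD1 0) //= (bigD1 1) //= mul1r subn1 subn0 big1 ?addr0; last first.
    move=> l l1; suff -> : (l == 1 :> nat) = false by rewrite mul0r.
    by apply/negbTE; rewrite -val_eqE in l1.
  rewrite big1 ?addr0 // => m m1; apply: big1 => l _.
  by rewrite -val_eqE /= in m1; rewrite (negPf m1) mul0r.
rewrite /vf_act big_ord_recl big_ord1 fps2_coefD !mxE !E /weight /=.
rewrite natrD !natrM mulrDl; congr (_ + _); rewrite -mulrA; congr (_ * _).
  by case: i {E} => [|i]; rewrite ?mul0r // mulr_natl.
by case: j {E} => [|j]; rewrite ?mul0r // mulr_natl.
Qed.

Lemma vf_bracket_eulerE p1 p2 (Z : 'cV[fps2 K]_2) m i j :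
  vf_bracket (euler K p1 p2) Z m 0 i j =
  ((p1 * i + p2 * j)%N%:Z - (weight p1 p2 m)%:Z)%:~R * Z m 0 i j.
Proof.
rewrite mxE fps2_coefB vf_act_eulerE.
suff -> : vf_act Z (euler K p1 p2 m 0) = (weight p1 p2 m)%:R *: Z m 0.
  by rewrite fps2_coefZ -mulrBl intrB.
have D (k : 'I_2) (w : K) : fps2_deriv k (w *: fps2_var K m) = (k == m)%:R * w%:A.
  apply/fps2P => a b; rewrite mulr_natl.
  have -> : (w%:A *+ (k == m) : fps2 K) a b =
      w * ((a == 0%N) && (b == 0%N))%:R *+ (k == m).
    by case: (k == m).
  case: k m => [[|[|//]] ?] [[|[|//]] ?] /=;
  case: a => [|[|a]]; case: b => [|[|b]] //=; rewrite ?mulr0 ?mul0rn ?mulr1n //.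
rewrite /vf_act (bigD1 m) //= big1 ?addr0 => [|k /negPf km].
  by rewrite mxE D eqxx mul1r -scalerAr mulr1.
by rewrite mxE D km mul0r mulr0.
Qed.

Lemma qh_fieldP p1 p2 k (Z : 'cV[fps2 K]_2) :
  qh_field p1 p2 k Z <-> qh_component p1 p2 k Z = Z.
Proof.
split=> [qhZ|<-].
  apply/matrixP => m n; rewrite ord1 mxE; apply/fps2P => i j /=.
  case: eqVneq => // neqk.
  move: qhZ => /matrixP /(_ m 0) /fps2P /(_ i j).
  rewrite vf_bracket_eulerE !mxE -scalerAl mul1r fps2_coefZ => /eqP.
  rewrite -subr_eq0 -mulrBl -intrB mulf_eq0 intr_eq0 subr_eq0 (negPf neqk) /=.
  by move=> /eqP.
apply/matrixP => m n; rewrite ord1; apply/fps2P => i j.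
rewrite vf_bracket_eulerE !mxE -scalerAl mul1r fps2_coefZ /=.
by case: eqP => [->//|_]; rewrite !mulr0.
Qed.

(* Absolute convergence on a polydisc of positive radius. *)
Definition convergent f : Prop :=
  exists r M : K, 0 < r /\ forall N : nat,
    \sum_(i < N) \sum_(j < N) `|f i j| * r ^+ (i + j) <= M.

(* The ideal (h_x, h_y) of the ring of convergent series. *)
Definition jacobian_ideal (h g : fps2 K) : Prop :=
  exists u v, [/\ convergent u, convergent v &
                  g = u * fps2_deriv 0 h + v * fps2_deriv 1 h].

(* The classes of the monomials a_i form a basis of the quotient of the ring of
   convergent series by (h_x, h_y): they are free, and they span. *)
Definition jacobian_basis (h : fps2 K) (mu : nat) (a : 'I_mu -> nat * nat) :
    Prop :=
  (forall c : 'I_mu -> K,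
     jacobian_ideal h (\sum_i c i *: fps2_mono K (a i)) -> forall i, c i = 0) /\
  (forall f, convergent f -> exists c : 'I_mu -> K,
     jacobian_ideal h (f - \sum_i c i *: fps2_mono K (a i))).

(* [h.[x, y]] substitutes x for the outer variable, so that [h^`()] is h_x and
   [map_poly deriv h] is h_y, as in [fps2_deriv_poly0] and [fps2_deriv_poly1]. *)
Definition isolated_singularity h : Prop :=
  [/\ h^`().[0, 0] = 0, (map_poly deriv h).[0, 0] = 0 &
      exists2 e : K, 0 < e & forall x y : K, `|x| < e -> `|y| < e ->
        h^`().[x, y] = 0 -> (map_poly deriv h).[x, y] = 0 -> x = 0 /\ y = 0].

(* Phi = exp Z: the coordinates of Phi are the sums of the series
   sum_n Z^n(x) / n! and sum_n Z^n(y) / n!, coefficientwise. The coefficients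
   converge in K, which makes sense of exp Z when Z has a nonzero linear part. *)
Definition is_exp (Z Phi : 'cV[fps2 K]_2) : Prop :=
  forall (k : 'I_2) (i j : nat),
    series (fun n => (n`!%:R)^-1 * iter n (vf_act Z) (fps2_var K k) i j) N
      @[N --> \oo] --> Phi k 0 i j.

End Analytic.

(* Main.v *)
Require Import Defs.
From mathcomp Require Import all_boot all_order all_algebra.
From mathcomp Require Import boolp filter topology normedtype.
From mathcomp Require Import sequences.
From mathcomp Require Import reals complex ring zify.

Set Implicit Arguments.
Unset Strict Implicit.
Unset Printing Implicit Defensive.

Import Order.TTheory GRing.Theory Num.Theory numFieldNormedType.Exports.
Local Open Scope ring_scope.

(* Write X0 for the Hamiltonian field, delta0 = delta - p1 - p2 for its degree.
   A basis of monomials modulo (h_x, h_y) makes h_x, h_y a regular sequence, so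
   the tangency X(h) = g h, compared with R(h) = delta h, gives X = u (X0 + v R)
   with u a unit and v of order > delta0.

   A fibered map is (s^p1 x, s^p2 y) for a unit s, and by homogeneity it
   conjugates X0 + v R to a multiple of X0 + w R exactly when
       s (v o Phi) = s^delta0 (w s + X0(s) + w R(s)).
   In each weight the linear part of this equation is f = X0(s) + w. It is
   solvable with w in the C[[h]]-span of the a_i: a series is a combination of
   the a_i plus Z(h) for some field Z, and subtracting from Z the multiple
   l R of R with the same divergence leaves a Hamiltonian field, so that Z(h) is
   X0(b) + delta l h, and l has lower weight. The nonlinear equation follows by
   successive approximation in the weight.

   Finally exp(bR) = (s^p1 x, s^p2 y) with s = sum_n (b (R + 1))^n (1) / n!, and
   b is recovered from s by successive approximation. *)

(** * The ring of formal power series *)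

Section Fps2.
Variable K : fieldType.
Implicit Types (f g q : fps2 K) (a b : nat * nat).

Lemma fps2_mono_mulE a f i j :
  (fps2_mono K a * f) i j =
  if (a.1 <= i)%N && (a.2 <= j)%N then f (i - a.1)%N (j - a.2)%N else 0.
Proof.
rewrite fps2_coefM; case: ifP => [/andP[ai aj]|aij].
  rewrite (bigD1 (Ordinal (ai : (a.1 < i.+1)%N))) //=.
  rewrite (bigD1 (Ordinal (aj : (a.2 < j.+1)%N))) //= !eqxx mul1r.
  rewrite big1 ?addr0 => [|l /negPf nl].
    rewrite big1 ?addr0 // => k /negPf nk; apply: big1 => l _.
    by rewrite -[_ == a.1]/(k == Ordinal (ai : (a.1 < i.+1)%N)) nk mul0r.
  by rewrite -[_ == a.2]/(l == Ordinal (aj : (a.2 < j.+1)%N)) nl mul0r.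
apply: big1 => k _; apply: big1 => l _ /=.
case: eqP => [ka|_]; last by rewrite mul0r.
case: eqP => [la|_]; last by rewrite mul0r.
by move: aij; rewrite -ka -la !leq_ord.
Qed.

Lemma fps2_monoM a b :
  fps2_mono K a * fps2_mono K b = fps2_mono K ((a.1 + b.1)%N, (a.2 + b.2)%N).
Proof.
apply/fps2P => i j; rewrite fps2_mono_mulE /=.
case: ifP => [/andP[ai aj]|aij]; first by congr (_ %:R); congr nat_of_bool; lia.
by case: eqP => //= ei; case: eqP => //= ej; move: aij; rewrite ei ej !leq_addr.
Qed.

Lemma fps2_mono0 : fps2_mono K (0%N, 0%N) = 1.
Proof. by apply/fps2P. Qed.

Lemma fps2_monoI a f g : fps2_mono K a * f = fps2_mono K a * g -> f = g.
Proof.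
move=> fg; apply/fps2P => i j; have := congr1 (fun F : fps2 K => F (a.1 + i)%N (a.2 + j)%N) fg.
by rewrite !fps2_mono_mulE !leq_addr !addKn.
Qed.

Lemma fps2_coef00M f g : (f * g) 0%N 0%N = f 0%N 0%N * g 0%N 0%N.
Proof. by rewrite fps2_coefM !big_ord1. Qed.

(** The product of the lexicographically lowest terms of two nonzero series cannot cancel;
    [(i0, j0)] and [(i1, j1)] are their exponents. *)
Lemma fps2_mulf_eq0 f g : f * g = 0 -> f = 0 \/ g = 0.
Proof.
have low (F : fps2 K) : F <> 0 -> exists i0 j0, [/\ F i0 j0 != 0,
    forall i j, (i < i0)%N -> F i j = 0 & forall j, (j < j0)%N -> F i0 j = 0].
  move=> F0; have exi : exists i, `[< exists j, F i j != 0 >].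
    apply: contrapT => nF; apply: F0; apply/fps2P => i j.
    apply/eqP/negPn/negP => Fij; apply: nF.
    by exists i; apply/asboolP; exists j.
  case: (ex_minnP exi) => i0 /asboolP exj mini.
  case: (ex_minnP exj) => j0 F00 minj; exists i0, j0; split => // [i j ii0|j jj0].
    apply/eqP/negPn/negP => Fij.
    have : (i0 <= i)%N by apply: mini; apply/asboolP; exists j.
    by rewrite leqNgt ii0.
  apply/eqP/negPn/negP => /minj; by rewrite leqNgt jj0.
move=> fg0; apply: contrapT => /not_orP[/low[i0 [j0 [f00 fi fj]]] /low[i1 [j1 [g11 gi gj]]]].
have := congr1 (fun F : fps2 K => F (i0 + i1)%N (j0 + j1)%N) fg0.
have hi : (i0 < (i0 + i1).+1)%N by rewrite ltnS leq_addr.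
have hj : (j0 < (j0 + j1).+1)%N by rewrite ltnS leq_addr.
rewrite fps2_coefM (bigD1 (Ordinal hi)) //= (bigD1 (Ordinal hj)) //= !addKn.
rewrite big1 ?addr0 => [|l]; last first.
  rewrite -val_eqE /= neq_ltn => /orP[lj|jl]; first by rewrite fj ?mul0r.
  by rewrite gj ?mulr0 //; have := ltn_ord l; lia.
rewrite big1 ?addr0 => [|k].
  by move/eqP; rewrite mulf_eq0 (negPf f00) (negPf g11).
rewrite -val_eqE /= neq_ltn => /orP[ki|ik]; apply: big1 => l _.
  by rewrite fi ?mul0r.
by rewrite gi ?mulr0 //; have := ltn_ord k; lia.
Qed.

Lemma fps2_mulIf f g q : q <> 0 -> q * f = q * g -> f = g.
Proof.
move=> q0 /eqP; rewrite -subr_eq0 -mulrBr => /eqP /fps2_mulf_eq0 [//|/eqP].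
by rewrite subr_eq0 => /eqP.
Qed.

(** A form of coprimality of x^N and y^N: cancelling q gives y^N P = x^N Q, so x^N divides P, and
    the quotient is the cofactor of q in f. *)
Lemma fps2_dvd_of_pure_powers N q f P Q : q <> 0 ->
  fps2_mono K (N, 0%N) * f = q * P -> fps2_mono K (0%N, N) * f = q * Q ->
  exists g, f = q * g.
Proof.
move=> q0 fP fQ.
have PQ : fps2_mono K (0%N, N) * P = fps2_mono K (N, 0%N) * Q.
  by apply: (fps2_mulIf q0); rewrite ![q * _]mulrCA -fP -fQ mulrCA.
have P0 i j : (i < N)%N -> P i j = 0.
  move=> iN; have := congr1 (fun F : fps2 K => F i (N + j)%N) PQ.
  by rewrite !fps2_mono_mulE /= leq_addr addKn subn0 (leqNgt N i) iN.
pose g : fps2 K := FPS2 (fun i j => P (N + i)%N j); exists g.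
apply: (@fps2_monoI (N, 0%N)); rewrite fP mulrCA; congr (_ * _).
apply/fps2P => i j; rewrite fps2_mono_mulE /= andbT.
by case: leqP => [Ni|/P0//]; rewrite subnKC ?subn0.
Qed.

End Fps2.

(** * Derivations and the action of vector fields *)

Section Derivations.
Variable K : numFieldType.
Implicit Types (f g q : fps2 K) (Z W : 'cV[fps2 K]_2).

Lemma vf_act_eulerM p1 p2 f g :
  vf_act (euler K p1 p2) (f * g) =
  vf_act (euler K p1 p2) f * g + f * vf_act (euler K p1 p2) g.
Proof.
apply/fps2P => i j; rewrite vf_act_eulerE fps2_coefD !fps2_coefM mulr_sumr.
rewrite -big_split; apply: eq_bigr => -[k /= ki] _.
rewrite mulr_sumr -big_split; apply: eq_bigr => -[l /= lj] _.
rewrite !vf_act_eulerE.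
have -> : (p1 * i + p2 * j = (p1 * k + p2 * l) + (p1 * (i - k) + p2 * (j - l)))%N.
  by rewrite addnACA -!mulnDr !subnKC.
by rewrite natrD; ring.
Qed.

(** The booleans serve as weights: x d/dx and y d/dy are the Euler fields of weights (1, 0) and (0,
    1). The Leibniz rule for derivatives then reduces to the one for Euler fields, after cancelling
    the variable. *)
Lemma fps2_derivE (k : 'I_2) f : fps2_var K k * fps2_deriv k f =
  vf_act (euler K (k == 0) (k != 0)) f.
Proof.
apply/fps2P => i j; rewrite vf_act_eulerE fps2_mono_mulE /fps2_deriv.
case: (k == 0) => /=.
  case: i => [|i] /=; first by rewrite !mul0n mul0r.
  by rewrite subn1 subn0 /= mul1n mul0n addn0 mulr_natl.
case: j => [|j] /=; first by rewrite ?andbF !mul0n muln0 mul0r.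
by rewrite subn1 subn0 /= mul1n mul0n add0n mulr_natl.
Qed.

Lemma fps2_derivM k f g :
  fps2_deriv k (f * g) = fps2_deriv k f * g + f * fps2_deriv k g.
Proof.
apply: (@fps2_monoI _ (if k == 0 then (1, 0)%N else (0, 1)%N)).
rewrite -/(fps2_var K k) mulrDr fps2_derivE mulrA mulrCA !fps2_derivE.
exact: vf_act_eulerM.
Qed.

Lemma fps2_derivD k f g : fps2_deriv k (f + g) = fps2_deriv k f + fps2_deriv k g.
Proof.
by rewrite /fps2_deriv; case: eqP => _; apply/fps2P => i j; rewrite /= mulrnDl.
Qed.

Lemma fps2_derivZ k (c : K) f : fps2_deriv k (c *: f) = c *: fps2_deriv k f.
Proof.
by rewrite /fps2_deriv; case: eqP => _; apply/fps2P => i j; rewrite /= mulrnAr.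
Qed.

Lemma fps2_deriv1 k : fps2_deriv k (1 : fps2 K) = 0.
Proof.
rewrite /fps2_deriv; case: eqP => _; apply/fps2P => i j /=; first by rewrite mul0rn.
by rewrite andbF mul0rn.
Qed.

Lemma vf_actE Z f : vf_act Z f = Z 0 0 * fps2_deriv 0 f + Z 1 0 * fps2_deriv 1 f.
Proof.
rewrite /vf_act big_ord_recl big_ord1; congr (_ + Z _ 0 * fps2_deriv _ f);
  exact: val_inj.
Qed.

Lemma vf_actM Z f g : vf_act Z (f * g) = vf_act Z f * g + f * vf_act Z g.
Proof. rewrite !vf_actE !fps2_derivM; ring. Qed.

Lemma vf_actD Z f g : vf_act Z (f + g) = vf_act Z f + vf_act Z g.
Proof. rewrite !vf_actE !fps2_derivD; ring. Qed.

Lemma vf_actZ Z (c : K) f : vf_act Z (c *: f) = c *: vf_act Z f.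
Proof. by rewrite !vf_actE !fps2_derivZ scalerDr !scalerAr. Qed.

Lemma vf_act1 Z : vf_act Z 1 = 0.
Proof. by rewrite !vf_actE !fps2_deriv1 !mulr0 addr0. Qed.

Lemma vf_act_addl Z W f : vf_act (Z + W) f = vf_act Z f + vf_act W f.
Proof. rewrite !vf_actE !mxE; ring. Qed.

Lemma vf_act_scalel g Z f : vf_act (g *: Z) f = g * vf_act Z f.
Proof. rewrite !vf_actE !mxE; ring. Qed.

Lemma vf_actX Z f n : vf_act Z (f ^+ n.+1) = n.+1%:R * (f ^+ n * vf_act Z f).
Proof.
elim: n => [|n IHn]; first by rewrite expr0 expr1 !mul1r.
by rewrite exprS vf_actM IHn -[n.+2%:R]natr1 exprS; ring.
Qed.

Lemma fps2_deriv_var l k : fps2_deriv l (fps2_var K k) = (l == k)%:R.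
Proof.
apply/fps2P => i j.
have -> : ((l == k)%:R : fps2 K) i j = (l == k)%:R * (1 : fps2 K) i j.
  by case: (l == k); rewrite ?mul1r ?mul0r.
rewrite fps2_coef1; case: l k => [[|[|//]] ?] [[|[|//]] ?] /=;
by case: i => [|[|i]]; case: j => [|[|j]] //=; rewrite ?mul0r ?mul1r ?mul0rn ?mulr1n.
Qed.

Lemma vf_act_var Z k : vf_act Z (fps2_var K k) = Z k 0.
Proof.
rewrite vf_actE !fps2_deriv_var.
by case: k => [[|[|//]] ?]; rewrite ?mulr1 ?mulr0 ?addr0 ?add0r;
  congr (Z _ _); apply: val_inj.
Qed.

End Derivations.

(** * Weights and successive approximation *)

Section Weights.
Variables (K : numFieldType) (p1 p2 : nat).
Implicit Types (f g q : fps2 K) (i j k l m n D : nat).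

Definition wdeg i j := (p1 * i + p2 * j)%N.

Local Notation wt := wdeg.

Definition eqmod n f g := forall i j, (wt i j < n)%N -> f i j = g i j.

Definition homog D q := forall i j, wt i j <> D -> q i j = 0.

Definition hom_part m f : fps2 K :=
  FPS2 (fun i j => if wt i j == m then f i j else 0).

Lemma hom_partE m f i j :
  hom_part m f i j = if wt i j == m then f i j else 0.
Proof. by []. Qed.

Lemma wt_subK i j k l : (k <= i)%N -> (l <= j)%N ->
  (wt k l + wt (i - k) (j - l) = wt i j)%N.
Proof. by move=> ki lj; rewrite /wdeg addnACA -!mulnDr !subnKC. Qed.

Lemma wtD i j k l : wt (i + k) (j + l) = (wt i j + wt k l)%N.
Proof. by rewrite /wdeg !mulnDr addnACA. Qed.

Lemma eqmod_refl n f : eqmod n f f. Proof. by []. Qed.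

Lemma eqmod_sym n f g : eqmod n f g -> eqmod n g f.
Proof. by move=> fg i j /fg. Qed.

Lemma eqmod_trans n f g q : eqmod n f g -> eqmod n g q -> eqmod n f q.
Proof. by move=> fg gq i j ijn; rewrite fg ?gq. Qed.

Lemma eqmod_leq m n f g : (m <= n)%N -> eqmod n f g -> eqmod m f g.
Proof. by move=> mn fg i j ijm; apply/fg/(leq_trans ijm). Qed.

Lemma eqmod_ext f g : (forall n, eqmod n f g) -> f = g.
Proof. by move=> fg; apply/fps2P => i j; apply: (fg (wt i j).+1). Qed.

Lemma eqmod_sub0 n f g : eqmod n f g <-> eqmod n (f - g) 0.
Proof.
split=> fg i j /fg; first by rewrite fps2_coefB => ->; rewrite subrr.
by rewrite fps2_coefB => /eqP; rewrite subr_eq0 => /eqP.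
Qed.

Lemma eqmodD n f f' g g' :
  eqmod n f f' -> eqmod n g g' -> eqmod n (f + g) (f' + g').
Proof. by move=> ff gg i j ijn; rewrite !fps2_coefD ff ?gg. Qed.

Lemma eqmodB n f f' g g' :
  eqmod n f f' -> eqmod n g g' -> eqmod n (f - g) (f' - g').
Proof. by move=> ff gg i j ijn; rewrite !fps2_coefB ff ?gg. Qed.

Lemma eqmodZ n (c : K) f g : eqmod n f g -> eqmod n (c *: f) (c *: g).
Proof. by move=> fg i j ijn; rewrite !fps2_coefZ fg. Qed.

Lemma eqmod_sum n I (r : seq I) (P : pred I) (F G : I -> fps2 K) :
  (forall x, eqmod n (F x) (G x)) ->
  eqmod n (\sum_(x <- r | P x) F x) (\sum_(x <- r | P x) G x).
Proof.
by move=> FG i j ijn; rewrite !fps2_coef_sum; apply: eq_bigr => x _; apply: FG.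
Qed.

Lemma eqmod_mul0 m n f g :
  eqmod m f 0 -> eqmod n g 0 -> eqmod (m + n) (f * g) 0.
Proof.
move=> fm gn i j ltij; rewrite fps2_coefM; apply: big1 => -[k /= ki] _.
apply: big1 => -[l /= lj] _; have [/fm->|mkl] := ltnP (wt k l) m.
  by rewrite mul0r.
rewrite gn ?mulr0 //; rewrite !ltnS in ki lj.
by move: ltij; rewrite -(wt_subK ki lj); lia.
Qed.

Lemma eqmod_mull0 n f g : eqmod n f 0 -> eqmod n (f * g) 0.
Proof. by move=> fn; rewrite -[n]addn0; apply: eqmod_mul0. Qed.

Lemma eqmod_mulr0 n f g : eqmod n g 0 -> eqmod n (f * g) 0.
Proof. by rewrite mulrC; apply: eqmod_mull0. Qed.

Lemma eqmodM n f f' g g' :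
  eqmod n f f' -> eqmod n g g' -> eqmod n (f * g) (f' * g').
Proof.
move=> /eqmod_sub0 ff /eqmod_sub0 gg; apply/eqmod_sub0.
have -> : f * g - f' * g' = (f - f') * g + f' * (g - g') by ring.
by rewrite -[0]addr0; apply: eqmodD; [apply: eqmod_mull0|apply: eqmod_mulr0].
Qed.

Lemma eqmodX n f g e : eqmod n f g -> eqmod n (f ^+ e) (g ^+ e).
Proof.
move=> fg; elim: e => [|e IHe]; first by rewrite !expr0.
by rewrite !exprS; exact: eqmodM.
Qed.

Lemma eqmod_euler n f g : eqmod n f g ->
  eqmod n (vf_act (euler K p1 p2) f) (vf_act (euler K p1 p2) g).
Proof. by move=> fg i j ijn; rewrite !vf_act_eulerE fg. Qed.

(** Under a homogeneous factor, f may thus be replaced by a series that agrees with it in a single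
    weight; equations can be solved weight by weight. *)
Lemma homog_mul_local D q f g i j : homog D q ->
  (forall k l, (wt k l + D = wt i j)%N -> f k l = g k l) ->
  (q * f) i j = (q * g) i j.
Proof.
move=> qD fg; rewrite !fps2_coefM; apply: eq_bigr => -[k /= ki] _.
apply: eq_bigr => -[l /= lj] _; rewrite !ltnS in ki lj.
have [wkl|/eqP/qD->] := eqVneq (wt k l) D; last by rewrite !mul0r.
by rewrite fg // -(wt_subK ki lj) wkl addnC.
Qed.

Lemma homog_mul_small D q f i j : homog D q -> (wt i j < D)%N -> (q * f) i j = 0.
Proof.
move=> qD ijD; rewrite (homog_mul_local (g := 0) qD) ?mulr0 // => k l; lia.
Qed.

Lemma homog_mono a : homog (wt a.1 a.2) (fps2_mono K a).
Proof. by move=> i j /=; case: eqP => // ->; case: eqP => // ->. Qed.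

Lemma homogM D E q f : homog D q -> homog E f -> homog (D + E) (q * f).
Proof.
move=> qD fE i j ij; rewrite (homog_mul_local (g := 0) qD) ?mulr0 // => k l kl.
by rewrite fE //; lia.
Qed.

Lemma hom_partM m D q f : homog D q ->
  hom_part m (q * f) = if (D <= m)%N then q * hom_part (m - D) f else 0.
Proof.
move=> qD; case: leqP => [Dm|mD]; apply/fps2P => i j; rewrite hom_partE;
  case: eqP => ijm //.
- apply: (homog_mul_local qD) => k l kl; rewrite hom_partE.
  by rewrite (_ : wt k l == m - D)%N //; apply/eqP; lia.
- rewrite (homog_mul_local (g := 0) qD) ?mulr0 // => k l kl; rewrite hom_partE.
  by case: eqP => // wkl; lia.
by rewrite (homog_mul_small _ qD) ?ijm.
Qed.

Lemma hom_partD m f g : hom_part m (f + g) = hom_part m f + hom_part m g.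
Proof. by apply/fps2P => i j; rewrite ?fps2_coefD !hom_partE; case: eqP => _; [rewrite ?fps2_coefD | rewrite addr0]. Qed.

Lemma hom_part_id m f : homog m f -> hom_part m f = f.
Proof. by move=> fm; apply/fps2P => i j; rewrite ?fps2_coefD !hom_partE; case: eqP => // /fm->. Qed.

(** Each homogeneous part of q f is q times a homogeneous part of f, and there are no zero
    divisors. *)
Lemma eqmod_div_homog D n q f : homog D q -> q <> 0 ->
  eqmod (D + n) (q * f) 0 -> eqmod n f 0.
Proof.
move=> qD q0 qf i j ijn.
have : q * hom_part (wt i j) f = 0.
  transitivity (hom_part (wt i j + D) (q * f)).
    by rewrite (hom_partM _ _ qD) leq_addl addnK.
  apply/fps2P => k l; rewrite hom_partE; case: eqP => // kl; apply: qf.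
  by rewrite kl addnC ltn_add2l.
move=> /fps2_mulf_eq0[//|/(congr1 (fun F : fps2 K => F i j))] /=.
by rewrite eqxx.
Qed.

(* [T] raises the order of contact, so [T^n 0] stabilizes in each weight. *)
Lemma fixpoint n0 (T : fps2 K -> fps2 K) :
  (forall f, eqmod n0 f 0 -> eqmod n0 (T f) 0) ->
  (forall n f g, eqmod n0 f 0 -> eqmod n0 g 0 ->
    eqmod (n0 + n) f g -> eqmod (n0 + n).+1 (T f) (T g)) ->
  exists2 f, eqmod n0 f 0 & T f = f.
Proof.
move=> T0 TS; pose F n := iter n T 0.
have F0 n : eqmod n0 (F n) 0 by elim: n => [|n IHn] //; apply: T0.
(* For contact of order below [n0] the hypothesis says nothing, but [T f] and [T g] then both vanish
   to order [n0]. *)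
have TS' n f g : eqmod n0 f 0 -> eqmod n0 g 0 -> eqmod n f g ->
    eqmod n.+1 (T f) (T g).
  move=> f0 g0 fg; have [n0n|nn0] := leqP n0 n.
    by have := @TS (n - n0)%N f g f0 g0; rewrite subnKC //; apply.
  apply: (eqmod_leq nn0); apply: eqmod_trans (T0 _ f0) _.
  exact/eqmod_sym/T0.
have FS n : eqmod n (F n) (F n.+1).
  elim: n => [|n IHn]; first by [].
  exact: (TS' _ _ _ (F0 n) (F0 n.+1) IHn).
have FF n m : eqmod n (F n) (F (n + m)%N).
  elim: m => [|m IHm]; first by rewrite addn0.
  apply: (eqmod_trans IHm); rewrite addnS.
  exact: (eqmod_leq (leq_addr m n) (FS _)).
(* A coefficient of weight n no longer changes after n + 1 iterations. *)
pose f : fps2 K := FPS2 (fun i j => F (wt i j).+1 i j).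
have fF n : eqmod n f (F n).
  by move=> i j ijn /=; rewrite -(subnKC ijn); exact: (FF _ _ _ _ (ltnSn _)).
exists f; first by apply: (eqmod_trans (fF n0)); apply: F0.
apply: eqmod_ext => n; apply: (@eqmod_trans _ _ (F n.+1)).
  apply: (@eqmod_leq _ n.+1) => //; apply: TS' => //.
  by apply: eqmod_trans (fF n0) _; apply: F0.
exact/eqmod_sym/(eqmod_leq (leqnSn n))/fF.
Qed.

Hypotheses (p1_gt0 : (0 < p1)%N) (p2_gt0 : (0 < p2)%N).

Lemma wt_eq0 i j : (wt i j == 0)%N = (i == 0%N) && (j == 0%N).
Proof. by rewrite /wdeg addn_eq0 !muln_eq0 (gtn_eqF p1_gt0) (gtn_eqF p2_gt0). Qed.

Lemma leq_wt i j : (i + j <= wt i j)%N.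
Proof. by apply: leq_add; apply: leq_pmull. Qed.

Lemma eqmod_exp0 n f : f 0%N 0%N = 0 -> eqmod n (f ^+ n) 0.
Proof.
move=> f0; elim: n => [|n IHn]; first by [].
rewrite exprS -add1n; apply: eqmod_mul0 => // i j.
by rewrite ltnS leqn0 wt_eq0 => /andP[/eqP-> /eqP->].
Qed.

Lemma eqmod1_coef00 f : f 0%N 0%N = 0 -> eqmod 1 f 0.
Proof. by move=> f0; rewrite -[f]expr1; apply: eqmod_exp0. Qed.

Lemma homogX D q n : homog D q -> homog (n * D) (q ^+ n).
Proof.
move=> qD; elim: n => [|n IHn]; last by rewrite exprS mulSn; apply: homogM.
by rewrite expr0 mul0n => i j /eqP; rewrite fps2_coef1 wt_eq0 => /negPf->.
Qed.

End Weights.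

(** * Division by the Jacobian ideal *)

Section Jacobian.
Variables (K : numFieldType) (p1 p2 : nat).
Implicit Types (f g q : fps2 K) (i j k l m n D : nat).

Local Notation wt := (wdeg p1 p2).
Local Notation homog := (@homog K p1 p2).
Local Notation hom_part := (@hom_part K p1 p2).
Local Notation euler := (euler K p1 p2).

Lemma qh_series_homog D f : qh_series p1 p2 D f -> homog D f.
Proof.
move=> fD i j /eqP ijD; have := congr1 (fun F : fps2 K => F i j) fD.
rewrite /= vf_act_eulerE => /eqP; rewrite -subr_eq0 -mulrBl mulf_eq0 subr_eq0.
by rewrite eqr_nat (negPf ijD) => /eqP.
Qed.

Lemma homog_deriv (x : 'I_2) D f :
  homog D f -> homog (D - weight p1 p2 x) (fps2_deriv x f).
Proof.
rewrite /fps2_deriv /weight => fD i j ij; case: (x == 0) ij => ij /=;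
  by rewrite fD ?mul0rn // => ijD; apply: ij; rewrite -ijD /wdeg; lia.
Qed.

Hypotheses (p1_gt0 : (0 < p1)%N) (p2_gt0 : (0 < p2)%N).

(** Positive weights leave finitely many monomials in each weight. Through homogeneous parts the
    spanning property, stated for convergent series, reaches formal ones. *)
Lemma convergent_hom_part m f : convergent (hom_part m f).
Proof.
have bound (F : nat -> K) N M : (forall i, 0 <= F i) ->
    (forall i, (M <= i)%N -> F i = 0) -> \sum_(i < N) F i <= \sum_(i < M) F i.
  move=> F0 FM; apply: (@le_trans _ _ (\sum_(i < M + N) F i)).
    rewrite addnC big_split_ord /= ler_wpDr //; exact: sumr_ge0.
  by rewrite big_split_ord /= [X in _ + X]big1 ?addr0 // => i _; rewrite FM ?leq_addr.
(* Since [i + j <= wt i j], all nonzero terms lie in the square [i, j <= m], whose full sum at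
   radius 1 bounds every partial sum. *)
exists 1, (\sum_(i < m.+1) \sum_(j < m.+1) `|hom_part m f i j| * 1 ^+ (i + j)).
split=> // N; have nneg i j : 0 <= `|hom_part m f i j| * 1 ^+ (i + j) :> K.
  by rewrite expr1n mulr1.
have zero i j : (m < i)%N || (m < j)%N ->
    `|hom_part m f i j| * 1 ^+ (i + j) = 0 :> K.
  rewrite hom_partE; case: eqP => [<-|_]; last by rewrite normr0 mul0r.
  have := leq_wt p1_gt0 p2_gt0 i j; lia.
apply: (@le_trans _ _ (\sum_(i < N) \sum_(j < m.+1) `|hom_part m f i j| * 1 ^+ (i + j))).
  apply: ler_sum => i _.
  apply: (bound (fun j => `|hom_part m f i j| * 1 ^+ (i + j))) => // j mj.
  by rewrite zero ?mj ?orbT.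
apply: (bound (fun i => \sum_(j < m.+1) `|hom_part m f i j| * 1 ^+ (i + j))) => i.
  by apply: sumr_ge0.
by move=> mi; apply: big1 => j _; rewrite zero ?mi.
Qed.

Variables (delta : nat) (h : fps2 K).
Hypothesis h_hom : homog delta h.

Local Notation hx := (fps2_deriv 0 h).
Local Notation hy := (fps2_deriv 1 h).

Variables (mu : nat) (a : 'I_mu -> nat * nat).
Hypothesis a_span : forall f, convergent f ->
  exists (c : 'I_mu -> K) u v,
    f = \sum_t c t *: fps2_mono K (a t) + (u * hx + v * hy).
Hypotheses (hx0 : hx 0%N 0%N = 0) (hy0 : hy 0%N 0%N = 0).

(** In the part of weight m of the spanning identity for the monomial, the a_t drop out, and
    membership in the ideal survives because h_x and h_y are homogeneous. *)
Lemma mono_in_jacobian b : (forall t, wt (a t).1 (a t).2 != wt b.1 b.2) ->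
  exists u v, fps2_mono K b = u * hx + v * hy.
Proof.
set m := wt b.1 b.2 => am.
have bE := hom_part_id (@homog_mono K p1 p2 b).
have [|c [u [v E]]] := a_span (f := fps2_mono K b).
  by rewrite -bE; apply: convergent_hom_part.
have sum0 : hom_part m (\sum_t c t *: fps2_mono K (a t)) = 0.
  apply/fps2P => i j; rewrite hom_partE; case: eqP => // ijm.
  rewrite fps2_coef_sum big1 // => t _; rewrite fps2_coefZ.
  rewrite (@homog_mono K p1 p2) ?mulr0 // ijm => am'.
  by have := am t; rewrite -am' eqxx.
rewrite -bE E -/m !hom_partD sum0 add0r ![_ * fps2_deriv _ _]mulrC.
rewrite !(hom_partM _ _ (homog_deriv h_hom)) /weight /=.
exists (if (delta - p1 <= m)%N then hom_part (m - (delta - p1)) u else 0).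
exists (if (delta - p2 <= m)%N then hom_part (m - (delta - p2)) v else 0).
by do 2?[case: ifP => _]; rewrite ?mul0r // ![_ * fps2_deriv _ _]mulrC.
Qed.

Lemma pure_powers_in_jacobian : exists N u v u' v',
  fps2_mono K (N, 0)%N = u * hx + v * hy /\
  fps2_mono K (0, N)%N = u' * hx + v' * hy.
Proof.
(* This N exceeds the weight of every a_t, while x^N and y^N have weight at least N. *)
pose N := (\sum_t wt (a t).1 (a t).2).+1; exists N.
have aN t : (wt (a t).1 (a t).2 < N)%N by rewrite ltnS (bigD1 t) //= leq_addr.
have [t|u [v uv]] := @mono_in_jacobian (N, 0)%N.
  by rewrite ltn_eqF // (leq_trans (aN t)) // (leq_trans _ (leq_wt _ _ _ _)) ?addn0.
have [t|u' [v' uv']] := @mono_in_jacobian (0, N)%N.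
  by rewrite ltn_eqF // (leq_trans (aN t)) // (leq_trans _ (leq_wt _ _ _ _)) ?addn0.
by exists u, v, u', v'.
Qed.

(** A common divisor of x^N and y^N divides 1, so it has a nonzero constant term. *)
Lemma not_dvd_pure_powers q N u v : q 0%N 0%N = 0 ->
  fps2_mono K (N, 0)%N = q * u -> fps2_mono K (0, N)%N = q * v -> False.
Proof.
move=> q0 uE vE; have q_neq0 : q <> 0.
  move=> qE; have := congr1 (fun F : fps2 K => F N 0%N) uE.
  by rewrite qE mul0r /= !eqxx => /eqP; rewrite oner_eq0.
have [||g gE] := @fps2_dvd_of_pure_powers K N q 1 u v q_neq0;
  rewrite ?mulr1 //.
have := congr1 (fun F : fps2 K => F 0%N 0%N) gE.
by rewrite fps2_coef00M q0 mul0r /= => /eqP; rewrite oner_eq0.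
Qed.

(** If one derivative vanished, both pure powers would be multiples of the other one, which is not a
    unit. *)
Lemma derivs_neq0 : hx <> 0 /\ hy <> 0.
Proof.
have [N [u [v [u' [v' [E E']]]]]] := pure_powers_in_jacobian.
split=> q0; move: E E'; rewrite q0 !mulr0 ?add0r ?addr0 ![_ * fps2_deriv _ _]mulrC.
  by move/not_dvd_pure_powers; apply.
by move/not_dvd_pure_powers; apply.
Qed.

(** Makes the degree of X0 a natural number. As h_x and h_y are nonzero without constant term, h
    contains some x^(i+1) y^j with (i, j) nonzero and some x^k y^(l+1) with (k, l) nonzero. *)
Lemma leq_delta : (p1 + p2 <= delta)%N.
Proof.
have ex f : f <> 0 -> exists i j, f i j != 0.
  move=> f0; apply: contrapT => nf; apply: f0; apply/fps2P => i j.
  by apply/eqP/negPn/negP => fij; apply: nf; exists i, j.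
have nz f i j : f 0%N 0%N = 0 -> f i j != 0 -> (0 < i)%N \/ (0 < j)%N.
  by case: i j => [|i] [|j] f0; [rewrite f0 eqxx|right|left|left].
have [/ex[i [j hij]] /ex[k [l hkl]]] := derivs_neq0.
have := nz _ _ _ hx0 hij; have := nz _ _ _ hy0 hkl.
have wij : wt i.+1 j = delta.
  by apply: contrapT => /h_hom; move: hij => /=; case: eqP => // h1 _ h2;
    apply: h1; rewrite h2 mul0rn.
have wkl : wt k l.+1 = delta.
  by apply: contrapT => /h_hom; move: hkl => /=; case: eqP => // h1 _ h2;
    apply: h1; rewrite h2 mul0rn.
(* Either one of the two monomials involves both variables, or delta is at least 2 p1 and at least 2
   p2. *)
move: wij wkl; rewrite /wdeg; nia.
Qed.

(** Regularity of the sequence h_x, h_y. Multiplying x^N = u h_x + v h_y by f and using f h_x = - g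
    h_y shows that h_y divides x^N f; it divides y^N f likewise, hence f. *)
Lemma koszul f g : f * hx + g * hy = 0 ->
  exists c, f = c * hy /\ g = - (c * hx).
Proof.
have [N [u [v [u' [v' [E E']]]]]] := pure_powers_in_jacobian.
have [_ hy_neq0] := derivs_neq0.
move=> /eqP; rewrite addr_eq0 => /eqP fg.
have mulE U V : (U * hx + V * hy) * f = hy * (V * f - U * g).
  by rewrite mulrDl -mulrA [hx * f]mulrC fg; ring.
have [||c cE] := @fps2_dvd_of_pure_powers K N hy f (v * f - u * g) (v' * f - u' * g) hy_neq0.
- by rewrite E mulE.
- by rewrite E' mulE.
exists c; split; first by rewrite mulrC.
apply: (fps2_mulIf hy_neq0); rewrite mulrC -[LHS]opprK -fg cE; ring.
Qed.

End Jacobian.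

(** * The homological equation *)

Section Comp1.
Variables (K : numFieldType) (h : fps2 K).
Hypothesis h0 : h 0%N 0%N = 0.
Implicit Types (d : nat -> K).

Lemma fps2_comp1E d N i j : (i + j < N)%N ->
  fps2_comp1 d h i j = (\sum_(n < N) d n *: h ^+ n) i j.
Proof.
move=> ijN; rewrite fps2_coef_sum /=.
rewrite (big_ord_widen N (fun n => d n * (h ^+ n) i j) ijN) big_mkcond /=.
apply: eq_bigr => n _; case: ltnP => // ijn.
by rewrite fps2_coefX_small ?mulr0.
Qed.

Lemma fps2_comp1_cons (c : K) d :
  fps2_comp1 (fun n => if n is n'.+1 then d n' else c) h =
  c *: 1 + h * fps2_comp1 d h.
Proof.
apply/fps2P => i j; rewrite (@fps2_comp1E _ (i + j).+2) // big_ord_recl expr0.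
rewrite !fps2_coefD; congr (_ + _).
transitivity ((h * \sum_(n < (i + j).+1) d n *: h ^+ n) i j).
  congr (fps2_coef _ i j); rewrite mulr_sumr; apply: eq_bigr => n _.
  by rewrite -scalerAr -exprS.
rewrite !fps2_coefM; apply: eq_bigr => k _; apply: eq_bigr => l _.
congr (_ * _); rewrite (@fps2_comp1E _ (i + j).+1) // ltnS.
by rewrite leq_add ?leq_subr.
Qed.

End Comp1.

Section Hamiltonian.
Variables (K : numFieldType) (delta : nat).
Implicit Types (h f g : fps2 K).

Lemma vf_act_hamiltonian h f : vf_act (hamiltonian delta h) f =
  delta%:R^-1 *: (fps2_deriv 1 h * fps2_deriv 0 f - fps2_deriv 0 h * fps2_deriv 1 f).
Proof. by rewrite vf_actE !mxE /= -!scalerAl -scalerDr mulNr. Qed.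

Lemma vf_act_hamiltonian_self h : vf_act (hamiltonian delta h) h = 0.
Proof. by rewrite vf_act_hamiltonian [_ * fps2_deriv 0 _]mulrC subrr scaler0. Qed.

(* The Poincare lemma in the plane. *)
Lemma divergence_free_hamiltonian f g : fps2_deriv 0 f + fps2_deriv 1 g = 0 ->
  exists b : fps2 K, [/\ b 0%N 0%N = 0, fps2_deriv 1 b = f & fps2_deriv 0 b = - g].
Proof.
move=> fg; exists (FPS2 (fun i j => if j is j'.+1 then f i j' / j%:R
  else if i is i'.+1 then - g i' 0%N / i%:R else 0)).
have nz n : n.+1%:R != 0 :> K by rewrite pnatr_eq0.
split=> //; apply/fps2P => i j; rewrite /fps2_deriv /=.
  by rewrite -[LHS]mulr_natr divfK.
case: j => [|j]; first by rewrite -[LHS]mulr_natr divfK.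
have := congr1 (fun F : fps2 K => F i j) fg; rewrite /= => /eqP.
rewrite addr_eq0 -[f _ _ *+ _]mulr_natr -[g _ _ *+ _]mulr_natr => /eqP fgE.
by rewrite -[LHS]mulr_natr mulrAC fgE mulNr mulfK.
Qed.

End Hamiltonian.

Section Homological.
Variables (K : numFieldType) (p1 p2 : nat).
Hypotheses (p1_gt0 : (0 < p1)%N) (p2_gt0 : (0 < p2)%N).
Implicit Types (f g q : fps2 K) (i j k l m n D : nat).

Local Notation wt := (wdeg p1 p2).
Local Notation homog := (@homog K p1 p2).
Local Notation hom_part := (@hom_part K p1 p2).
Local Notation euler := (euler K p1 p2).

Variables (delta : nat) (h : fps2 K).
Hypotheses (h_hom : homog delta h) (delta_ge : (p1 + p2 <= delta)%N).

Local Notation hx := (fps2_deriv 0 h).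
Local Notation hy := (fps2_deriv 1 h).
Local Notation X0 := (hamiltonian delta h).

Variables (mu : nat) (a : 'I_mu -> nat * nat).
Hypothesis a_span : forall f, convergent f ->
  exists (c : 'I_mu -> K) u v,
    f = \sum_t c t *: fps2_mono K (a t) + (u * hx + v * hy).

Local Notation combination d :=
  (\sum_t fps2_comp1 (d t) h * fps2_mono K (a t)).

Lemma delta_gt0 : (0 < delta)%N.
Proof. by apply: leq_trans delta_ge; rewrite addn_gt0 p1_gt0. Qed.

Lemma delta_neq0 : delta%:R != 0 :> K.
Proof. by rewrite pnatr_eq0 -lt0n delta_gt0. Qed.

Lemma homog_coef00 : h 0%N 0%N = 0.
Proof. by apply: h_hom; rewrite /wdeg !muln0 => d0; have := delta_gt0; rewrite -d0. Qed.

Lemma euler_h : vf_act euler h = delta%:R *: h.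
Proof.
apply/fps2P => i j; rewrite vf_act_eulerE fps2_coefZ -/(wt i j).
by have [->|/eqP/h_hom->] := eqVneq (wt i j) delta; rewrite ?mulr0.
Qed.

Lemma vf_act_X0_hmul f : vf_act X0 (h * f) = h * vf_act X0 f.
Proof. by rewrite vf_actM vf_act_hamiltonian_self mul0r add0r. Qed.

(** [X0] raises weights by delta - p1 - p2, written additively to avoid truncated subtraction, and
    it kills constants. *)
Lemma vf_act_X0_local f g i j :
  (forall k l, (wt k l + delta = wt i j + p1 + p2)%N -> (0 < k + l)%N ->
    f k l = g k l) ->
  vf_act X0 f i j = vf_act X0 g i j.
Proof.
move=> fg; rewrite !vf_act_hamiltonian !fps2_coefZ !fps2_coefB; congr (_ * (_ - _)).
  apply: (homog_mul_local (homog_deriv h_hom)) => k l; rewrite /weight /= => kl.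
  by rewrite fg //; move: kl delta_ge; rewrite /wdeg; nia.
apply: (homog_mul_local (homog_deriv h_hom)) => k l; rewrite /weight /= => kl.
by rewrite fg //; move: kl delta_ge; rewrite /wdeg; nia.
Qed.

(** As h^n a_t is homogeneous, each [d t n] enters in exactly one weight. Solutions chosen
    independently in each weight can therefore be glued. *)
Lemma combination_local (d d' : 'I_mu -> nat -> K) i j :
  (forall t n, (n * delta + wt (a t).1 (a t).2 = wt i j)%N -> d t n = d' t n) ->
  combination d i j = combination d' i j.
Proof.
move=> dd; rewrite !fps2_coef_sum; apply: eq_bigr => t _.
rewrite ![_ * fps2_mono _ _]mulrC !fps2_mono_mulE; case: ifP => // /andP[ai aj].
apply: eq_bigr => -[n /= _] _.
have [E|/eqP nE] := eqVneq (wt (i - (a t).1) (j - (a t).2)) (n * delta)%N.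
  by rewrite dd // -E addnC wt_subK.
by rewrite (homogX p1_gt0 p2_gt0 h_hom nE) !mulr0.
Qed.

Lemma jacobian_ideal_decomposition u v :
  exists l b : fps2 K, b 0%N 0%N = 0 /\ u * hx + v * hy = h * l + vf_act X0 b.
Proof.
(* The divergence of c R is R(c) + (p1 + p2) c, so [w i j] is the eigenvalue of this operator on x^i
   y^j, and [c] below gives c R the divergence of the field (u, v). *)
pose w i j : K := (wt i j + p1 + p2)%:R.
have w_neq0 i j : w i j != 0 by rewrite pnatr_eq0; lia.
pose c : fps2 K := FPS2 (fun i j =>
  (fps2_deriv 0 u + fps2_deriv 1 v) i j / w i j).
pose A := u - p1%:R *: (fps2_var K 0 * c).
pose B := v - p2%:R *: (fps2_var K 1 * c).
have divE : fps2_deriv 0 A + fps2_deriv 1 B = 0.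
  have cE : vf_act euler c + (p1 + p2)%:R *: c = fps2_deriv 0 u + fps2_deriv 1 v.
    apply/fps2P => i j; rewrite !fps2_coefD vf_act_eulerE fps2_coefZ -mulrDl.
    by rewrite -natrD addnA mulrC divfK // w_neq0.
  have dN x f : fps2_deriv x (- f) = - fps2_deriv x f.
    by rewrite -scaleN1r fps2_derivZ scaleN1r.
  rewrite /A /B !fps2_derivD !dN !fps2_derivZ !fps2_derivM addrACA -cE.
  have dv (x : 'I_2) : fps2_deriv x (fps2_var K x) = 1.
    by rewrite fps2_deriv_var eqxx.
  rewrite !dv !mul1r vf_actE !mxE /weight /= natrD scalerDl !scalerDr -!scalerAl.
  ring.
have [b [b0 by_ bx]] := divergence_free_hamiltonian divE.
(* R(h) = delta h gives the first factor. With A = b_y and B = - b_x, the rest A h_x + B h_y equals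
   - delta X0(b), whence the sign. *)
exists (delta%:R *: c), (- delta%:R *: b); split.
  by rewrite fps2_coefZ b0 mulr0.
have hE : p1%:R *: (fps2_var K 0 * hx) + p2%:R *: (fps2_var K 1 * hy) = delta%:R *: h.
  by rewrite -euler_h vf_actE !mxE /weight /= -!scalerAl.
have natZ n f : n%:R *: f = n%:R * f by rewrite scaler_nat mulr_natl.
rewrite vf_actZ vf_act_hamiltonian by_ bx scalerA mulNr divff ?delta_neq0 //.
rewrite scaleN1r -scalerAr scalerAl -hE -[u](subrK (p1%:R *: (fps2_var K 0 * c))).
rewrite -/A -[v](subrK (p2%:R *: (fps2_var K 1 * c))) -/B !natZ; ring.
Qed.

(* Dividing in the Jacobian ideal produces multiples of [h], to which the
   decomposition applies again, in lower weight. *)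
Lemma homological m f : exists (d : 'I_mu -> nat -> K) (b : fps2 K), b 0%N 0%N = 0 /\
  forall i j, wt i j = m -> f i j = (combination d + vf_act X0 b) i j.
Proof.
elim/ltn_ind: m f => m IHm f.
have [c [u [v fE]]] := a_span (convergent_hom_part p1_gt0 p2_gt0 m f).
have [g [b [b0 uvE]]] := jacobian_ideal_decomposition u v.
have [d [b' [b'0 gE]]] : exists (d : 'I_mu -> nat -> K) (b' : fps2 K), b' 0%N 0%N = 0 /\
    forall k l, (wt k l + delta = m)%N ->
      g k l = (combination d + vf_act X0 b') k l.
  have [lt_m|le_m] := ltnP m delta.
    (* Below weight delta the product h g has no part of weight m, so nothing has to be solved. *)
    by exists (fun _ _ => 0), 0; split => // k l; lia.
  have [|d [b' [b'0 gE]]] := IHm (m - delta)%N _ g.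
    by have := delta_gt0; lia.
  by exists d, b'; split => // k l kl; apply: gE; lia.
(* The constants c become the coefficients of h^0 and the recursive solution is multiplied by h;
   X0(h b') = h X0(b') because X0(h) = 0. *)
exists (fun t n => if n is n'.+1 then d t n' else c t), (b + h * b').
split; first by rewrite fps2_coefD fps2_coef00M b0 b'0 mulr0 addr0.
move=> i j ijm; transitivity (hom_part m f i j).
  by rewrite hom_partE ijm eqxx.
rewrite fE uvE vf_actD vf_act_X0_hmul.
have -> : combination (fun t n => if n is n'.+1 then d t n' else c t) =
    \sum_t c t *: fps2_mono K (a t) + h * combination d.
  rewrite mulr_sumr -big_split; apply: eq_bigr => t _ /=.
  by rewrite (fps2_comp1_cons homog_coef00) mulrDl -scalerAl mul1r mulrA.
rewrite [X in _ = fps2_coef X i j](_ : _ = \sum_t c t *: fps2_mono K (a t) +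
  (h * (combination d + vf_act X0 b') + vf_act X0 b)); last by ring.
rewrite !fps2_coefD; congr (_ + (_ + _)).
by apply: (homog_mul_local h_hom) => k l kl; rewrite gE // kl.
Qed.

End Homological.

(** Both sides run over the pairs with sum below N, as in a Cauchy product; the right side groups
    them by that sum. *)
Lemma sum_triangle (V : nmodType) (F : nat -> nat -> V) N :
  \sum_(n < N) \sum_(m < N - n) F n m = \sum_(r < N) \sum_(k < r.+1) F k (r - k)%N.
Proof.
elim: N => [|N IHN]; first by rewrite !big_ord0.
rewrite [RHS]big_ord_recr -IHN big_ord_recr /= subSnn big_ord1.
rewrite [X in _ = _ + X]big_ord_recr /= subnn addrA; congr (_ + _).
rewrite -big_split; apply: eq_bigr => -[n /= nN] _.
by rewrite subSn 1?ltnW // big_ord_recr.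
Qed.

(** * Fibered exponentials *)

Section FiberedExponential.
Variables (K : numFieldType) (p1 p2 : nat).
Hypotheses (p1_gt0 : (0 < p1)%N) (p2_gt0 : (0 < p2)%N).
Implicit Types (b f g s : fps2 K) (i j k n m e : nat).

Local Notation wt := (wdeg p1 p2).
Local Notation eqmod := (@eqmod K p1 p2).
Local Notation euler := (euler K p1 p2).

(* If [R z = e z], then [bR (z f) = z twist e b f]. *)
Definition twist e b f : fps2 K := b * (vf_act euler f + e%:R *: f).

(** When R z = e z, the product of z with this series is the n-th term of exp(bR)(z). *)
Definition exp_term e b n : fps2 K := n`!%:R^-1 *: iter n (twist e b) 1.

Arguments exp_term : simpl never.

(** The cut-off in each weight is harmless when b has no constant term, since [exp_term e b n] then
    has order at least n. *)
Definition exp_sum e b : fps2 K :=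
  FPS2 (fun i j => (\sum_(n < (wt i j).+1) exp_term e b n) i j).

Lemma twistD e b f g : twist e b (f + g) = twist e b f + twist e b g.
Proof. by rewrite /twist vf_actD scalerDr -mulrDr addrACA. Qed.

Lemma twistZ e b c f : twist e b (c *: f) = c *: twist e b f.
Proof. by rewrite /twist vf_actZ scalerA [_ * c]mulrC -scalerA -scalerDr -scalerAr. Qed.

Lemma twist0 e b : twist e b 0 = 0.
Proof. by rewrite -[X in twist _ _ X](scale0r 0) twistZ scale0r. Qed.

Lemma twist_sum e b I (r : seq I) (F : I -> fps2 K) :
  twist e b (\sum_(x <- r) F x) = \sum_(x <- r) twist e b (F x).
Proof. by apply: (big_morph (twist e b)); [apply: twistD | apply: twist0]. Qed.

Lemma twistM e e' b f g :
  twist (e + e') b (f * g) = twist e b f * g + f * twist e' b g.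
Proof.
rewrite /twist vf_actM natrD scalerDl [e%:R *: (f * g)]scalerAl.
rewrite [e'%:R *: (f * g)]scalerAr; ring.
Qed.

Lemma exp_term0 e b : exp_term e b 0 = 1.
Proof. by rewrite /exp_term invr1 scale1r. Qed.

Lemma exp_termS e b n :
  n.+1%:R *: exp_term e b n.+1 = twist e b (exp_term e b n).
Proof.
rewrite /exp_term twistZ scalerA factS natrM invfM mulrA divff ?mul1r //.
by rewrite pnatr_eq0.
Qed.

Lemma exp_termD e e' b n :
  exp_term (e + e') b n =
  \sum_(k < n.+1) exp_term e b k * exp_term e' b (n - k)%N.
Proof.
elim: n => [|n IHn]; first by rewrite big_ord1 !exp_term0 mulr1.
have n_neq0 : n.+1%:R != 0 :> K by rewrite pnatr_eq0.
apply: (scalerI n_neq0); rewrite exp_termS IHn twist_sum.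
under eq_bigr do rewrite twistM -!exp_termS.
rewrite big_split /=; symmetry.
(* As in the proof of the binomial formula, the factor n + 1 is split as k + (n + 1 - k) in the k-th
   term. *)
transitivity (\sum_(k < n.+2) ((k%:R *: exp_term e b k) * exp_term e' b (n.+1 - k)%N
    + exp_term e b k * ((n.+1 - k)%:R *: exp_term e' b (n.+1 - k)%N))).
  rewrite scaler_sumr; apply: eq_bigr => -[k /= kn] _.
  rewrite -[k%:R *: _ * _]scalerAl -[_ * ((_ - _)%:R *: _)]scalerAr -scalerDl.
  by rewrite -natrD subnKC.
rewrite big_split /= big_ord_recl scale0r mul0r add0r; congr (_ + _).
rewrite big_ord_recr /= subnn scale0r mulr0 addr0.
by apply: eq_bigr => -[k /= kn] _; rewrite subSn.
Qed.

Lemma iter_twist_order e b n : b 0%N 0%N = 0 -> eqmod n (iter n (twist e b) 1) 0.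
Proof.
move=> b0; elim: n => [|n IHn]; first by [].
rewrite iterS -add1n; apply: eqmod_mul0; first exact: eqmod1_coef00.
move=> i j ijn; rewrite fps2_coefD vf_act_eulerE fps2_coefZ IHn //.
by rewrite !mulr0 addr0.
Qed.

Lemma exp_term_order e b n : b 0%N 0%N = 0 -> eqmod n (exp_term e b n) 0.
Proof. by move=> b0; rewrite -(scaler0 _ n`!%:R^-1); apply/eqmodZ/iter_twist_order. Qed.

Lemma exp_sum_trunc e b N : b 0%N 0%N = 0 ->
  eqmod N (exp_sum e b) (\sum_(n < N) exp_term e b n).
Proof.
move=> b0 i j ijN; rewrite [LHS]fps2_coef_sum fps2_coef_sum.
rewrite (big_ord_widen N (fun n => exp_term e b n i j) ijN) big_mkcond.
by apply: eq_bigr => n _; case: ltnP => // nij; exact/esym/(exp_term_order e b0).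
Qed.

(** Multiplicativity of the exponential of a derivation. It turns [exp_sum e b] into the e-th power
    of s = [exp_sum 1 b], so that exp(bR) has the form (s^p1 x, s^p2 y). *)
Lemma exp_sumD e e' b : b 0%N 0%N = 0 ->
  exp_sum (e + e') b = exp_sum e b * exp_sum e' b.
Proof.
move=> b0; apply: (@eqmod_ext K p1 p2) => N; apply: eqmod_trans (exp_sum_trunc _ b0) _.
under eq_bigr do rewrite exp_termD.
rewrite -(sum_triangle (fun n m => exp_term e b n * exp_term e' b m)).
apply: eqmod_sym; apply: eqmod_trans (eqmodM (exp_sum_trunc _ b0) (exp_sum_trunc _ b0)) _.
rewrite mulr_suml; apply: eqmod_sum => -[n /= nN]; rewrite mulr_sumr => i j ijN.
rewrite !fps2_coef_sum.
(* Widening the inner sum to N only adds terms with n + m >= N, which vanish to order N. *)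
rewrite (big_ord_widen N (fun m => (exp_term e b n * exp_term e' b m) i j) (leq_subr n N)).
rewrite [RHS]big_mkcond; apply: eq_bigr => m _; case: ltnP => // Nm.
apply: (eqmod_mul0 (exp_term_order _ b0) (exp_term_order _ b0)).
by apply: leq_trans ijN _; rewrite -leq_subLR.
Qed.

Lemma exp_sum0 b : exp_sum 0 b = 1.
Proof.
apply/fps2P => i j; rewrite [LHS]/(fps2_coef (\sum_(n < _) exp_term 0 b n) i j).
rewrite big_ord_recl exp_term0 big1 ?addr0 // => n _.
rewrite /exp_term iterSr [twist 0 b 1](_ : _ = 0); last first.
  by rewrite /twist vf_act1 scale0r addr0 mulr0.
by rewrite iter_fix ?scaler0 // twist0.
Qed.

Lemma exp_sumX e b : b 0%N 0%N = 0 -> exp_sum 1 b ^+ e = exp_sum e b.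
Proof.
move=> b0; elim: e => [|e IHe]; first by rewrite expr0 exp_sum0.
by rewrite exprS IHe -exp_sumD.
Qed.

Lemma exp_sum_coef00 e b : exp_sum e b 0%N 0%N = 1.
Proof. by rewrite /= /wdeg !muln0 big_ord1 exp_term0. Qed.

Lemma iter_vf_act_var b (x : 'I_2) n :
  iter n (vf_act (b *: euler)) (fps2_var K x) =
  fps2_var K x * iter n (twist (weight p1 p2 x) b) 1.
Proof.
elim: n => [|n IHn]; first by rewrite mulr1.
rewrite !iterS IHn vf_act_scalel vf_actM vf_act_var mxE /twist -!scalerAl scalerAr.
ring.
Qed.

Lemma is_exp_fibered b (Phi : 'cV[fps2 K]_2) : b 0%N 0%N = 0 ->
  (forall x, Phi x 0 = fps2_var K x * exp_sum 1 b ^+ weight p1 p2 x) ->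
  is_exp (b *: euler) Phi.
Proof.
(* Because b has no constant term, each coefficient of the partial sums is eventually constant. *)
move=> b0 PhiE x i j; apply: cvg_near_cst.
near=> N; rewrite PhiE exp_sumX //.
have ijN : (wt i j < N)%N by near: N; exact: nbhs_infty_gt.
rewrite (eqmodM (@eqmod_refl K p1 p2 N _) (exp_sum_trunc _ b0)) //.
rewrite mulr_sumr fps2_coef_sum seriesEord; apply: eq_bigr => n _.
by rewrite -scalerAr fps2_coefZ iter_vf_act_var.
Unshelve. all: by end_near.
Qed.

(** Unlike [eqmodM], this counts the order of vanishing of the other factor, which is the gain
    needed for contraction. *)
Lemma eqmodM_lip N m m' n n' f f' g g' : (N <= m + n)%N -> (N <= m' + n')%N ->
  eqmod m f f' -> eqmod n g 0 -> eqmod m' f' 0 -> eqmod n' g g' ->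
  eqmod N (f * g) (f' * g').
Proof.
move=> Nmn Nmn' /eqmod_sub0 ff g0 f0 /eqmod_sub0 gg; apply/eqmod_sub0.
have -> : f * g - f' * g' = (f - f') * g + f' * (g - g') by ring.
rewrite -[0]addr0; apply: eqmodD.
  by apply: eqmod_leq Nmn _; apply: eqmod_mul0.
by apply: eqmod_leq Nmn' _; apply: eqmod_mul0.
Qed.

(** The series [exp_sum 1 b] is 1 + b plus terms with at least two factors b. So b + (s -
    [exp_sum 1 b]) depends on b only through these terms, which gain an order of contact as b
    vanishes at 0. *)
Lemma exp_sum_surj s : s 0%N 0%N = 1 ->
  exists2 b : fps2 K, b 0%N 0%N = 0 & exp_sum 1 b = s.
Proof.
move=> s0; have [||b b1 bE] := @fixpoint K p1 p2 1 (fun b : fps2 K => b + (s - exp_sum 1 b)).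
- move=> b b1 i j; rewrite ltnS leqn0 (wt_eq0 p1_gt0 p2_gt0) => /andP[/eqP-> /eqP->].
  by rewrite fps2_coefD fps2_coefB s0 exp_sum_coef00 subrr addr0 b1 // /wdeg !muln0.
- move=> n b b' b1 b'1 bb'.
  have b0 : b 0%N 0%N = 0 by apply: b1; rewrite /wdeg !muln0.
  have b'0 : b' 0%N 0%N = 0 by apply: b'1; rewrite /wdeg !muln0.
  (* Each factor b beyond the first contributes one more order of contact. *)
  have iterE k : eqmod (1 + n + k) (iter k.+1 (twist 1 b) 1) (iter k.+1 (twist 1 b') 1).
    elim: k => [|k IHk].
      rewrite addn0 !iterS /twist /= vf_act1; apply: eqmodM => //.
    rewrite [iter k.+2 _ _]iterS [iter k.+2 _ (_ : fps2 K)]iterS.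
    apply: (@eqmodM_lip _ (1 + n) 1 k.+1 (1 + n + k)) => //; try lia.
      move=> i j ijk; rewrite fps2_coefD vf_act_eulerE fps2_coefZ.
      by rewrite (iter_twist_order 1 b0) // !mulr0 addr0.
    apply: eqmodD; first exact: eqmod_euler.
    exact: eqmodZ.
  have termE k : (1 < k)%N -> eqmod (1 + n).+1 (exp_term 1 b k) (exp_term 1 b' k).
    case: k => [|[|k]] // _; apply/eqmodZ/eqmod_leq/iterE; lia.
  have sumE (d : fps2 K) : d 0%N 0%N = 0 ->
      eqmod (1 + n).+1 (d + (s - exp_sum 1 d)) (s - 1 - \sum_(k < n) exp_term 1 d k.+2).
    move=> d0; have -> : s - 1 - \sum_(k < n) exp_term 1 d k.+2 =
      d + (s - \sum_(k < n.+2) exp_term 1 d k).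
      rewrite !big_ord_recl /= exp_term0 /exp_term /= invr1 scale1r /twist vf_act1.
      by rewrite add0r scale1r mulr1; ring.
    apply: eqmodD; first exact: eqmod_refl.
    by apply: eqmodB; [apply: eqmod_refl | apply: exp_sum_trunc].
  apply: eqmod_trans (sumE _ b0) _; apply: eqmod_trans _ (eqmod_sym (sumE _ b'0)).
  by apply: eqmodB => //; apply: eqmod_sum => k; apply: termE.
exists b; first by apply: b1; rewrite /wdeg !muln0.
by move: bE => /(canRL (addKr _)); rewrite addNr => /eqP; rewrite subr_eq0 => /eqP.
Qed.

End FiberedExponential.

(** * Fibered substitutions *)

Section Substitution.
Variables (K : numFieldType) (p1 p2 : nat).
Implicit Types (e : nat -> nat -> fps2 K) (f g q s : fps2 K) (i j k l n m : nat).

Local Notation wt := (wdeg p1 p2).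
Local Notation eqmod := (@eqmod K p1 p2).

(* [subst_with e f] is the sum of the [f k l x^k y^l e k l]. *)
Definition subst_with e f : fps2 K := FPS2 (fun i j =>
  \sum_(k < i.+1) \sum_(l < j.+1) f k l * e k l (i - k)%N (j - l)%N).

(* Substitution of [s^p1 x] for [x] and of [s^p2 y] for [y]. *)
Definition fiber_subst s f := subst_with (fun k l => s ^+ wt k l) f.

Lemma subst_withE e f i j : subst_with e f i j =
  \sum_(k < i.+1) \sum_(l < j.+1) f k l * e k l (i - k)%N (j - l)%N.
Proof. by []. Qed.

Lemma subst_with1 f : subst_with (fun _ _ => 1) f = f.
Proof. by rewrite -[RHS]mulr1. Qed.

Lemma eq_subst_with e e' f : (forall k l, f k l != 0 -> e k l = e' k l) ->
  subst_with e f = subst_with e' f.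
Proof.
move=> ee; apply/fps2P => i j; rewrite !subst_withE.
apply: eq_bigr => k _; apply: eq_bigr => l _.
by have [->|/ee->] := eqVneq (f k l) 0; rewrite ?mul0r.
Qed.

Lemma subst_with_trunc e f N i j : (i < N)%N -> (j < N)%N ->
  subst_with e f i j =
  (\sum_(k < N) \sum_(l < N) f k l *: (fps2_mono K (k : nat, l : nat) * e k l)) i j.
Proof.
move=> iN jN; rewrite fps2_coef_sum subst_withE.
rewrite (big_ord_widen N (fun k => \sum_(l < j.+1) f k l * e k l (i - k)%N (j - l)%N) iN).
rewrite big_mkcond; apply: eq_bigr => k _; rewrite fps2_coef_sum ltnS.
case: leqP => [ki|ik].
  rewrite (big_ord_widen N (fun l => f k l * e k l (i - k)%N (j - l)%N) jN).
  rewrite big_mkcond; apply: eq_bigr => l _; rewrite ltnS fps2_coefZ.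
  by rewrite fps2_mono_mulE ki /=; case: ifP; rewrite ?mulr0.
rewrite big1 // => l _; rewrite fps2_coefZ fps2_mono_mulE /=.
by rewrite (leqNgt k) ik mulr0.
Qed.

Lemma subst_withZ e c f : subst_with e (c *: f) = c *: subst_with e f.
Proof.
apply/fps2P => i j; rewrite fps2_coefZ !subst_withE mulr_sumr.
by apply: eq_bigr => k _; rewrite mulr_sumr; apply: eq_bigr => l _; rewrite mulrA.
Qed.

Lemma subst_withD e f g : subst_with e (f + g) = subst_with e f + subst_with e g.
Proof.
apply/fps2P => i j; rewrite fps2_coefD !subst_withE -big_split.
apply: eq_bigr => k _; rewrite -big_split; apply: eq_bigr => l _.
by rewrite fps2_coefD mulrDl.
Qed.

Lemma subst_with_sum e I (r : seq I) (F : I -> fps2 K) :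
  subst_with e (\sum_(x <- r) F x) = \sum_(x <- r) subst_with e (F x).
Proof.
apply: (big_morph (subst_with e)) => [f g|]; first exact: subst_withD.
by rewrite -[X in subst_with e X](scale0r 0) subst_withZ scale0r.
Qed.

Lemma subst_with_mono e a : subst_with e (fps2_mono K a) = fps2_mono K a * e a.1 a.2.
Proof.
apply/fps2P => i j; rewrite subst_withE fps2_coefM.
apply: eq_bigr => k _; apply: eq_bigr => l _ /=.
case: eqP => [->|_]; last by rewrite !mul0r.
by case: eqP => [->|_]; last by rewrite !mul0r.
Qed.

Lemma subst_with_eqmod e n f g :
  eqmod n f g -> eqmod n (subst_with e f) (subst_with e g).
Proof.
move=> fg i j ijn; rewrite !subst_withE; apply: eq_bigr => -[k /= ki] _.
apply: eq_bigr => -[l /= lj] _; rewrite fg //; apply: leq_ltn_trans ijn.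
by rewrite -(wt_subK p1 p2 (ki : (k <= i)%N) (lj : (l <= j)%N)) leq_addr.
Qed.

Lemma fiber_subst_homog s D q : homog p1 p2 D q ->
  fiber_subst s q = s ^+ D * q.
Proof.
move=> qD; rewrite mulrC; apply/fps2P => i j.
rewrite /fiber_subst subst_withE fps2_coefM; apply: eq_bigr => k _.
apply: eq_bigr => l _; have [->//|/eqP/qD->] := eqVneq (wt k l) D.
by rewrite !mul0r.
Qed.

Hypotheses (p1_gt0 : (0 < p1)%N) (p2_gt0 : (0 < p2)%N).

Lemma subst_with_eqmod_trunc e f N : eqmod N (subst_with e f)
  (\sum_(k < N) \sum_(l < N) f k l *: (fps2_mono K (k : nat, l : nat) * e k l)).
Proof.
move=> i j ijN; have ij := leq_ltn_trans (leq_wt p1_gt0 p2_gt0 i j) ijN.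
by apply: subst_with_trunc; lia.
Qed.

Lemma eqmod_trunc f N : eqmod N f
  (\sum_(k < N) \sum_(l < N) f k l *: fps2_mono K (k : nat, l : nat)).
Proof.
have := @subst_with_eqmod_trunc (fun _ _ => 1) f N; rewrite subst_with1.
by under eq_bigr do under eq_bigr do rewrite mulr1.
Qed.

Lemma mul_subst_with q e f :
  q * subst_with e f = subst_with (fun k l => q * e k l) f.
Proof.
apply: (@eqmod_ext K p1 p2) => N.
apply: eqmod_trans (eqmodM (@eqmod_refl _ p1 p2 N q) (@subst_with_eqmod_trunc e f N)) _.
apply: eqmod_trans _ (eqmod_sym (@subst_with_eqmod_trunc _ f N)).
have -> // : q * (\sum_(k < N) \sum_(l < N) f k l *: (fps2_mono K (k : nat, l : nat) * e k l)) =
  \sum_(k < N) \sum_(l < N) f k l *: (fps2_mono K (k : nat, l : nat) * (q * e k l)).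
rewrite mulr_sumr; apply: eq_bigr => k _; rewrite mulr_sumr; apply: eq_bigr => l _.
by rewrite -scalerAr mulrCA.
Qed.

(** On monomials this is additivity of weights in the exponent of s; truncation and bilinearity give
    the rest. *)
Lemma fiber_substM s f g :
  fiber_subst s (f * g) = fiber_subst s f * fiber_subst s g.
Proof.
apply: (@eqmod_ext K p1 p2) => N.
apply: eqmod_trans (subst_with_eqmod _ (eqmodM (@eqmod_trunc f N) (@eqmod_trunc g N))) _.
apply: eqmod_trans _ (eqmodM (eqmod_sym (@subst_with_eqmod_trunc _ f N))
  (eqmod_sym (@subst_with_eqmod_trunc _ g N))).
set u := subst_with _ _; set v := (X in eqmod N u X).
have -> // : u = v.
rewrite /u /v !mulr_suml subst_with_sum; apply: eq_bigr => k _.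
rewrite !mulr_suml subst_with_sum; apply: eq_bigr => l _.
rewrite !mulr_sumr subst_with_sum; apply: eq_bigr => m _.
rewrite !mulr_sumr subst_with_sum; apply: eq_bigr => n _.
rewrite -!scalerAl -!scalerAr !subst_withZ; congr (_ *: (_ *: _)).
rewrite fps2_monoM subst_with_mono /= wtD exprD.
rewrite -(fps2_monoM _ (k : nat, l : nat) (m : nat, n : nat)).
by rewrite mulrACA.
Qed.

Lemma fps2_mono_exp a n :
  fps2_mono K a ^+ n = fps2_mono K ((n * a.1)%N, (n * a.2)%N).
Proof.
elim: n => [|n IHn]; first by rewrite expr0 !mul0n fps2_mono0.
by rewrite exprS IHn fps2_monoM !mulSn.
Qed.

Lemma fps2_comp_fibered s f (Phi : 'cV[fps2 K]_2) :
  (forall x, Phi x 0 = fps2_var K x * s ^+ weight p1 p2 x) ->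
  fps2_comp f Phi = fiber_subst s f.
Proof.
move=> PhiE; apply/fps2P => i j.
rewrite /fiber_subst (@subst_with_trunc _ _ (i + j).+1) ?ltnS ?leq_addr ?leq_addl //.
rewrite fps2_coef_sum; apply: eq_bigr => k _.
rewrite fps2_coef_sum; apply: eq_bigr => l _; rewrite fps2_coefZ; congr (_ * fps2_coef _ i j).
rewrite !PhiE !exprMn -!exprM mulrACA -exprD /fps2_var !fps2_mono_exp fps2_monoM /=.
by rewrite !muln0 !muln1 addn0 add0n.
Qed.

End Substitution.

(** * The conjugacy equation *)

Section NormalForm.
Variables (K : numFieldType) (p1 p2 : nat).
Hypotheses (p1_gt0 : (0 < p1)%N) (p2_gt0 : (0 < p2)%N).
Implicit Types (f g q s : fps2 K) (i j k l m n D : nat).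

Local Notation wt := (wdeg p1 p2).
Local Notation homog := (@homog K p1 p2).
Local Notation hom_part := (@hom_part K p1 p2).
Local Notation eqmod := (@eqmod K p1 p2).
Local Notation euler := (euler K p1 p2).

Variables (delta0 : nat) (h : fps2 K).
Local Notation delta := (delta0 + (p1 + p2))%N.
Hypothesis h_hom : homog delta h.

Local Notation hx := (fps2_deriv 0 h).
Local Notation hy := (fps2_deriv 1 h).
Local Notation X0 := (hamiltonian delta h).

Variables (mu : nat) (a : 'I_mu -> nat * nat).
Hypothesis a_span : forall f, convergent f ->
  exists (c : 'I_mu -> K) u v,
    f = \sum_t c t *: fps2_mono K (a t) + (u * hx + v * hy).

Local Notation combination d :=
  (\sum_t fps2_comp1 (d t) h * fps2_mono K (a t)).

Let delta_ge : (p1 + p2 <= delta)%N. Proof. exact: leq_addl. Qed.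

Lemma vf_act_X0_eqmod n f g :
  eqmod n f g -> eqmod (delta0 + n) (vf_act X0 f) (vf_act X0 g).
Proof.
move=> fg i j ijn; apply: (vf_act_X0_local _ _ h_hom delta_ge) => // k l kl _.
by apply: fg; lia.
Qed.

(* Solving the homological equation separately in each weight makes the
   solution operators compatible with truncation. *)
Lemma homological_operators :
  exists (d : fps2 K -> 'I_mu -> nat -> K) (b : fps2 K -> fps2 K),
  [/\ forall f, b f 0%N 0%N = 0,
      forall f, f = combination (d f) + vf_act X0 (b f) &
      forall n f g, eqmod (delta0 + n) f g -> eqmod n (b f) (b g)].
Proof.
have [sol solP] : exists sol : nat * fps2 K -> ('I_mu -> nat -> K) * fps2 K,
    forall mf, (sol mf).2 0%N 0%N = 0 /\ forall i j, wt i j = mf.1 ->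
      mf.2 i j = (combination (sol mf).1 + vf_act X0 (sol mf).2) i j.
  pose P (mf : nat * fps2 K) (db : ('I_mu -> nat -> K) * fps2 K) :=
    db.2 0%N 0%N = 0 /\ forall i j, wt i j = mf.1 ->
      mf.2 i j = (combination db.1 + vf_act X0 db.2) i j.
  suff /choice[sol solP] : forall mf, exists db, P mf db by exists sol.
  move=> [m f].
  have [d [b dbP]] := homological p1_gt0 p2_gt0 h_hom delta_ge a_span m f.
  by exists (d, b).
(* Applying [sol] to the homogeneous part makes the choice depend on nothing else of f. *)
pose d m f := (sol (m, hom_part m f)).1; pose b m f := (sol (m, hom_part m f)).2.
exists (fun f t n => d (n * delta + wt (a t).1 (a t).2)%N f t n).
(* X0 sends weight n to weight delta0 + n, so the weight n part of b is read from the solution in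
   weight delta0 + n. *)
exists (fun f => FPS2 (fun i j => b (delta0 + wt i j)%N f i j)); split.
- by move=> f; have [] := solP (delta0 + wt 0 0, hom_part (delta0 + wt 0 0) f)%N.
- move=> f; apply/fps2P => i j; set m := wt i j.
  have [_ /(_ i j erefl)] := solP (m, hom_part m f).
  rewrite hom_partE eqxx => ->; rewrite !fps2_coefD; congr (_ + _).
    by apply: (combination_local p1_gt0 p2_gt0 h_hom) => t n ->.
  apply: (vf_act_X0_local _ _ h_hom delta_ge) => // k l kl _ /=.
  by rewrite (_ : (delta0 + wt k l)%N = m) // /m; lia.
move=> n f g fg i j ijn /=; rewrite /b.
suff -> : hom_part (delta0 + wt i j)%N f = hom_part (delta0 + wt i j)%N g by [].
apply/fps2P => k l; rewrite !hom_partE; case: eqP => // kl; apply: fg.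
by rewrite kl ltn_add2l.
Qed.

(** The unknown is the right-hand side f of the homological equation, with s = 1 + b(f) and w = f -
    X0(b(f)). Divided by s^delta0, the equation reads V(s) = f + w (b + R(b)), a fixed point problem
    for f. *)
Lemma conjugacy_equation v : eqmod delta0.+1 v 0 ->
  exists (d : 'I_mu -> nat -> K) s, s 0%N 0%N = 1 /\
    s * fiber_subst p1 p2 s v =
    s ^+ delta0 * (combination d * s + vf_act X0 s + combination d * vf_act euler s).
Proof.
move=> v0; have [d [b [b0 dbE b_eqmod]]] := homological_operators.
(* This is s (v o Phi) / s^delta0. The truncated subtraction is exact on the terms of v, whose
   weights exceed delta0. *)
pose V s := subst_with (fun k l => s ^+ ((wt k l).+1 - delta0)) v.
(* Written as a difference because compatibility with truncation is known for [b] and not for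
   [d]. *)
pose w f := f - vf_act X0 (b f).
have wE f : w f = combination (d f) by rewrite /w {1}[f]dbE addrK.
have V_eqmod n s s' : eqmod n s s' -> eqmod (delta0.+1 + n) (V s) (V s').
  move=> ss i j ijn; rewrite /V !subst_withE; apply: eq_bigr => -[k /= ki] _.
  apply: eq_bigr => -[l /= lj] _; rewrite !ltnS in ki lj.
  have [kl|kl] := leqP (wt k l) delta0; first by rewrite (v0 k l kl) !fps2_coef0 !mul0r.
  congr (_ * _); apply: (eqmodX _ ss).
  by move: ijn; rewrite -(wt_subK p1 p2 ki lj); lia.
have V0 s : eqmod delta0.+1 (V s) 0.
  move=> i j ijn; rewrite /V subst_withE; apply: big1 => -[k /= ki] _.
  apply: big1 => -[l /= lj] _; rewrite !ltnS in ki lj.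
  by rewrite v0 ?mul0r // (leq_ltn_trans _ ijn) // -(wt_subK p1 p2 ki lj) leq_addr.
have w_eqmod n f g : eqmod (delta0 + n) f g -> eqmod (delta0 + n) (w f) (w g).
  by move=> fg; apply: eqmodB => //; apply: vf_act_X0_eqmod; apply: b_eqmod.
have w0 f : eqmod delta0.+1 f 0 -> eqmod delta0.+1 (w f) 0.
  move=> f0; rewrite -[0]subr0; apply: eqmodB => //.
  rewrite -[X in eqmod _ _ X](_ : vf_act X0 0 = 0); last first.
    by rewrite -[X in vf_act _ X](scale0r 0) vf_actZ scale0r.
  rewrite -addn1; apply: vf_act_X0_eqmod; exact: eqmod1_coef00.
pose B f := b f + vf_act euler (b f).
have B_eqmod n f g : eqmod (delta0 + n) f g -> eqmod n (B f) (B g).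
  by move=> fg; apply: eqmodD; [|apply: eqmod_euler]; apply: b_eqmod.
have B0 f : eqmod 1 (B f) 0.
  apply: eqmod1_coef00 => //.
  by rewrite fps2_coefD vf_act_eulerE b0 mulr0 addr0.
pose T f := V (1 + b f) - w f * B f.
have [||f f0 fE] := @fixpoint K p1 p2 delta0.+1 T.
- move=> f f0; rewrite -[0]subr0; apply: eqmodB; first exact: V0.
  by apply: eqmod_mull0; apply: w0.
- move=> n f g f0 g0; rewrite addSnnS => fg; apply: eqmodB.
    rewrite -addSn; apply: V_eqmod; apply: eqmodD; last exact: b_eqmod.
    exact: eqmod_refl.
  (* The extra order comes from B, which vanishes at 0, and from w, which has order above delta0. *)
  apply: (@eqmodM_lip _ _ _ _ (delta0 + n.+1) delta0.+1 1 n.+1); try lia.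
  + exact: w_eqmod.
  + exact: B0.
  + exact: w0.
  + exact: B_eqmod.
exists (d f), (1 + b f); split; first by rewrite fps2_coefD b0 addr0.
have VE : (1 + b f) * fiber_subst p1 p2 (1 + b f) v = (1 + b f) ^+ delta0 * V (1 + b f).
  rewrite /V /fiber_subst !(mul_subst_with p1_gt0 p2_gt0); apply: eq_subst_with => k l vkl.
  rewrite -exprS -exprD subnKC //; case: leqP => // kl.
  by move: vkl; rewrite v0 ?fps2_coef0 ?eqxx //; lia.
rewrite VE -wE; congr (_ * _).
have /eqP := fE; rewrite subr_eq => /eqP ->.
rewrite {1}[f](_ : f = w f + vf_act X0 (b f)); last by rewrite subrK.
rewrite !vf_actD !vf_act1 /B; ring.
Qed.

End NormalForm.

(** * Fibered normal form *)

Section Assembly.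
Variables (K : numFieldType) (p1 p2 : nat).
Hypotheses (p1_gt0 : (0 < p1)%N) (p2_gt0 : (0 < p2)%N).
Implicit Types (f g q s : fps2 K) (i j k l m n D : nat).

Local Notation wt := (wdeg p1 p2).
Local Notation homog := (@homog K p1 p2).
Local Notation eqmod := (@eqmod K p1 p2).
Local Notation euler := (euler K p1 p2).
Local Notation weight := (weight p1 p2).

Lemma homog_eqmod0 D q : homog D q -> eqmod D q 0.
Proof. by move=> qD i j ijD; apply: qD => ijE; rewrite ijE ltnn in ijD. Qed.

Lemma homogZ D (c : K) q : homog D q -> homog D (c *: q).
Proof. by move=> qD i j /qD qij; rewrite fps2_coefZ qij mulr0. Qed.

Lemma homog_var (x : 'I_2) : homog (weight x) (fps2_var K x).
Proof.
rewrite /weight /fps2_var; case: eqP => _.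
  by have := @homog_mono K p1 p2 (1, 0)%N; rewrite /= /wdeg muln1 muln0 addn0.
by have := @homog_mono K p1 p2 (0, 1)%N; rewrite /= /wdeg muln1 muln0 add0n.
Qed.

Lemma fps2_var_coef00 (x : 'I_2) : fps2_var K x 0%N 0%N = 0.
Proof. by rewrite /fps2_var; case: eqP. Qed.

Section Fibered.
Variables (s : fps2 K) (Phi : 'cV[fps2 K]_2).
Hypothesis s0 : s 0%N 0%N = 1.
Hypothesis PhiE : forall x, Phi x 0 = fps2_var K x * s ^+ weight x.

(** Since s(0) = 1, the Jacobian matrix at the origin is the identity. *)
Lemma jacobian_fibered_unit : jacobian Phi \in unitmx.
Proof.
have sX n : (s ^+ n) 0%N 0%N = 1.
  elim: n => [|n IHn]; first by rewrite expr0.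
  by rewrite exprS fps2_coef00M s0 IHn mul1r.
have JE x y : fps2_deriv y (Phi x 0) 0%N 0%N = (y == x)%:R.
  rewrite PhiE fps2_derivM fps2_deriv_var fps2_coefD !fps2_coef00M.
  rewrite fps2_var_coef00 mul0r addr0 sX mulr1.
  by case: (y == x).
rewrite unitmxE (expand_det_row _ 0) !big_ord_recl big_ord0 /cofactor !det_mx11 !mxE.
rewrite fps2_unitE addr0 fps2_coefD !fps2_coef00M !JE /=.
by rewrite mul0r addr0 !mul1r oner_eq0.
Qed.

Lemma formal_diffeo_fibered : formal_diffeo Phi.
Proof.
split; last exact: jacobian_fibered_unit.
by move=> x; rewrite PhiE fps2_coef00M fps2_var_coef00 mul0r.
Qed.

Lemma jacobian_mul (Y : 'cV[fps2 K]_2) x : (jacobian Phi *m Y) x 0 = vf_act Y (Phi x 0).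
Proof. by rewrite mxE; apply: eq_bigr => y _; rewrite mxE mulrC. Qed.

Variables (delta0 : nat) (X X0 : 'cV[fps2 K]_2) (u v w : fps2 K).
Hypothesis X0_hom : forall x, homog (delta0 + weight x) (X0 x 0).
Hypotheses (u0 : u 0%N 0%N != 0) (XE : X = u *: (X0 + v *: euler)).
Hypothesis sE : s * fiber_subst p1 p2 s v =
  s ^+ delta0 * (w * s + vf_act X0 s + w * vf_act euler s).

(** With z a coordinate of weight p, (X0 + w R)(z s^p) is s^p X0(z) + p z s^(p-1) (w s + X0(s) + w
    R(s)). Multiplied by s^delta0, the last bracket becomes s (v o Phi) by [sE], which gives the
    z-component of X o Phi up to the factor u o Phi. *)
Lemma orbitally_conjugates_fibered :
  orbitally_conjugates Phi X (X0 + w *: euler).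
Proof.
have substE := fun f => fps2_comp_fibered f PhiE.
exists (fiber_subst p1 p2 s u * s ^+ delta0); split.
  rewrite fps2_coef00M (_ : (s ^+ delta0) 0%N 0%N = 1) ?mulr1; last first.
    elim: delta0 => [|n IHn]; first by rewrite expr0.
    by rewrite exprS fps2_coef00M s0 IHn mul1r.
  by rewrite /fiber_subst subst_withE !big_ord1 /= /wdeg !muln0 addn0 mulr1.
set c := fiber_subst p1 p2 s u * _.
rewrite /vf_pullback; apply: (canLR (mulKmx jacobian_fibered_unit)).
apply/matrixP => x y; rewrite ord1 jacobian_mul mxE substE XE !mxE.
rewrite fiber_substM //.
have -> : fiber_subst p1 p2 s (X0 x 0 + v * ((weight x)%:R *: fps2_var K x)) =
    s ^+ (delta0 + weight x) * X0 x 0 +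
    fiber_subst p1 p2 s v * (s ^+ weight x * ((weight x)%:R *: fps2_var K x)).
  rewrite /fiber_subst subst_withD -/(fiber_subst p1 p2 s _) (fiber_subst_homog s (@X0_hom x)).
  congr (_ + _).
  rewrite -/(fiber_subst p1 p2 s (v * _)) fiber_substM //; congr (_ * _).
  by rewrite (fiber_subst_homog s (homogZ _ (@homog_var x))).
rewrite vf_act_scalel PhiE vf_actM vf_act_var !mxE vf_act_addl vf_act_scalel /c.
(* Positivity lets the weight be written n + 1, so that the power s^(p-1) is s^n. *)
have : (0 < weight x)%N by rewrite /Defs.weight; case: eqP.
case: (weight x) => // n _; rewrite !vf_actX exprD.
rewrite scaler_nat !exprS.
have -> : fiber_subst p1 p2 s v * (s * s ^+ n * (fps2_var K x *+ n.+1)) =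
  s * fiber_subst p1 p2 s v * (s ^+ n * (fps2_var K x *+ n.+1)) by ring.
rewrite sE; ring.
Qed.

End Fibered.

Variables (delta : nat) (h : fps2 K).
Hypothesis h_hom : homog delta h.

Local Notation hx := (fps2_deriv 0 h).
Local Notation hy := (fps2_deriv 1 h).
Local Notation X0 := (hamiltonian delta h).

Variables (mu : nat) (a : 'I_mu -> nat * nat).
Hypothesis a_span : forall f, convergent f ->
  exists (c : 'I_mu -> K) u v,
    f = \sum_t c t *: fps2_mono K (a t) + (u * hx + v * hy).
Hypotheses (hx0 : hx 0%N 0%N = 0) (hy0 : hy 0%N 0%N = 0).

Lemma perturbation_decomposition delta0 X : delta = (delta0 + (p1 + p2))%N ->
  perturbation p1 p2 delta h X -> exists u v : fps2 K,
  [/\ u 0%N 0%N = 1, eqmod delta0.+1 v 0 & X = u *: (X0 + v *: euler)].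
Proof.
move=> deltaE [X_comp [g gE]].
have delta_ge : (p1 + p2 <= delta)%N by rewrite deltaE leq_addl.
have dN0 := delta_neq0 K p1_gt0 delta_ge.
have dZ n f : n%:R *: f = n%:R * f by rewrite scaler_nat mulr_natl.
have [hx_neq0 hy_neq0] := derivs_neq0 p1_gt0 p2_gt0 h_hom a_span hx0 hy0.
have h_neq0 : h <> 0.
  move=> hE; apply: hx_neq0; rewrite hE /fps2_deriv /=.
  by apply/fps2P => i j; rewrite /= mul0rn.
(* Chosen so that X - v1 R annihilates h; [koszul] then makes this field a multiple of X0. *)
pose v1 := delta%:R^-1 *: g.
have hE : delta%:R *: h = p1%:R *: fps2_var K 0 * hx + p2%:R *: fps2_var K 1 * hy.
  by rewrite -(euler_h h_hom) vf_actE !mxE.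
have [|c [cx cy]] := koszul p1_gt0 p2_gt0 h_hom a_span hx0 hy0
    (f := X 0 0 - v1 * (p1%:R *: fps2_var K 0)) (g := X 1 0 - v1 * (p2%:R *: fps2_var K 1)).
  transitivity (vf_act X h - v1 * (delta%:R *: h)); first by rewrite vf_actE hE; ring.
  by rewrite gE /v1 -scalerAl -scalerAr scalerA mulVf // scale1r subrr.
pose u := delta%:R *: c.
have Y_order x : eqmod (delta0 + weight x).+1 (X x 0 - X0 x 0) 0.
  move=> i j ijn.
  have le_delta0 : ((wt i j)%:Z - (weight x)%:Z <= delta%:Z - p1%:Z - p2%:Z)%R.
    by rewrite deltaE; lia.
  have := X_comp _ le_delta0; move=> /matrixP /(_ x 0) /(congr1 (fun F : fps2 K => F i j)).
  by rewrite !mxE /= eqxx.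
have hx_hom : homog (delta0 + p2) hx.
  by have := homog_deriv (x := 0) h_hom; rewrite deltaE /Defs.weight /= addnA addnAC addnK.
have hy_hom : homog (delta0 + p1) hy.
  by have := homog_deriv (x := 1) h_hom; rewrite deltaE /Defs.weight /= addnA addnK.
(* As X0(h) = 0, the product g h equals (X - X0)(h), of order above delta0 + delta; division by h
   leaves order above delta0. *)
have g_order : eqmod delta0.+1 g 0.
  apply: (eqmod_div_homog h_hom h_neq0); rewrite mulrC -gE.
  have -> : vf_act X h = (X 0 0 - X0 0 0) * hx + (X 1 0 - X0 1 0) * hy.
    rewrite -[LHS]subr0 -(vf_act_hamiltonian_self delta h) !vf_actE; ring.
  rewrite -[Y in eqmod _ _ Y]addr0; apply: eqmodD.
    apply: eqmod_leq (eqmod_mul0 (Y_order 0) (homog_eqmod0 hx_hom)).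
    by rewrite deltaE /Defs.weight /=; lia.
  apply: eqmod_leq (eqmod_mul0 (Y_order 1) (homog_eqmod0 hy_hom)).
  by rewrite deltaE /Defs.weight /=; lia.
have v1_order : eqmod delta0.+1 v1 0.
  by rewrite -(scaler0 _ delta%:R^-1); apply: eqmodZ.
have X0x : X0 0 0 = delta%:R^-1 *: hy by rewrite mxE.
have X0y : X0 1 0 = - (delta%:R^-1 *: hx) by rewrite mxE /= scalerN.
have Xx : X 0 0 = u * X0 0 0 + v1 * (p1%:R *: fps2_var K 0).
  by apply/eqP; rewrite -subr_eq cx X0x /u -scalerAl -scalerAr scalerA mulfV // scale1r.
have Xy : X 1 0 = u * X0 1 0 + v1 * (p2%:R *: fps2_var K 1).
  by apply/eqP; rewrite -subr_eq cy X0y /u mulrN -scalerAl -scalerAr scalerA mulfV // scale1r.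
(* Up to a constant, h_y (u - 1) is the x-component of X - X0 - v1 R, of order above delta0 + p1,
   which is the weight of h_y. *)
have u0 : u 0%N 0%N = 1.
  have : eqmod 1 (u - 1) 0.
    apply: (eqmod_div_homog hy_hom hy_neq0).
    have -> : hy * (u - 1) =
        delta%:R *: ((X 0 0 - X0 0 0) - v1 * (p1%:R *: fps2_var K 0)).
      rewrite Xx X0x -[hy](scalerK dN0) scalerA mulVf // scale1r.
      rewrite (_ : _ - _ - _ = (delta%:R^-1 *: hy) * (u - 1)); last by ring.
      by rewrite -scalerAl scalerA mulfV // scale1r.
    rewrite -(scaler0 _ delta%:R); apply: eqmodZ; rewrite -[Y in eqmod _ _ Y]subr0; apply: eqmodB.
      apply: eqmod_leq (Y_order 0); by rewrite /Defs.weight /=; lia.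
    apply: eqmod_leq (eqmod_mul0 v1_order (homog_eqmod0 (homogZ p1%:R (@homog_var 0)))).
    by rewrite /Defs.weight /=; lia.
  move=> /(_ 0%N 0%N); rewrite /wdeg !muln0 => /(_ isT)/eqP.
  by rewrite fps2_coefB fps2_coef1 subr_eq0 => /eqP.
have u_unit : u \is a GRing.unit by rewrite fps2_unitE u0 oner_eq0.
exists u, (u^-1 * v1); split => //; first exact: eqmod_mulr0.
apply/matrixP => x y; rewrite ord1 !mxE mulrDr -[u^-1 * _ * _]mulrA mulVKr //.
case: x => [[|[|//]] xlt].
  rewrite (_ : Ordinal xlt = 0) ?Xx ?mxE //; exact: val_inj.
rewrite (_ : Ordinal xlt = 1) ?Xy ?mxE //; exact: val_inj.
Qed.

Lemma fibered_normal_form X : perturbation p1 p2 delta h X ->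
  exists (d : 'I_mu -> nat -> K) Phi,
    [/\ formal_diffeo Phi,
        orbitally_conjugates Phi X (X0 +
          \sum_t (fps2_comp1 (d t) h * fps2_mono K (a t)) *: euler)
      & exists b : fps2 K, is_exp (b *: euler) Phi].
Proof.
move=> X_pert.
have delta_ge := leq_delta p1_gt0 p2_gt0 h_hom a_span hx0 hy0.
have [delta0 deltaE] : exists n, delta = (n + (p1 + p2))%N.
  by exists (delta - (p1 + p2))%N; rewrite subnK.
have [u [v [u0 v0 XE]]] := perturbation_decomposition deltaE X_pert.
have [d [s [s0 sE]]] : exists (d : 'I_mu -> nat -> K) (s : fps2 K), s 0%N 0%N = 1 /\
    let w := \sum_t fps2_comp1 (d t) h * fps2_mono K (a t) in
    s * fiber_subst p1 p2 s v =
      s ^+ delta0 * (w * s + vf_act X0 s + w * vf_act euler s).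
  move: h_hom a_span; rewrite deltaE => hh hspan.
  exact: (conjugacy_equation p1_gt0 p2_gt0 hh hspan v0).
have [b b0 bE] := exp_sum_surj p1_gt0 p2_gt0 s0.
pose Phi : 'cV[fps2 K]_2 := \col_x (fps2_var K x * s ^+ weight x).
have PhiE x : Phi x 0 = fps2_var K x * s ^+ weight x by rewrite mxE.
have X0_hom x : homog (delta0 + weight x) (X0 x 0).
  rewrite mxE; apply: homogZ; case: x => [[|[|//]] xlt]; rewrite /Defs.weight /=.
    by have := homog_deriv (x := 1) h_hom; rewrite deltaE /Defs.weight /= addnA addnK.
  have := homog_deriv (x := 0) h_hom; rewrite deltaE /Defs.weight /= addnA addnAC addnK.
  by move=> hx_hom i j /hx_hom hij; rewrite fps2_coefN hij oppr0.
exists d, Phi; split; first exact: formal_diffeo_fibered s0 PhiE.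
  rewrite -scaler_suml; apply: (orbitally_conjugates_fibered s0 PhiE X0_hom _ XE sE).
  by rewrite u0 oner_eq0.
exists b; apply: (is_exp_fibered p1_gt0 p2_gt0 b0) => x.
by rewrite bE PhiE.
Qed.

End Assembly.

Theorem mainTheorem4 (R : realType) (p1 p2 delta : nat)
    (h : {poly {poly R[i]}}) (mu : nat) (a : 'I_mu -> nat * nat)
    (X : 'cV[fps2 R[i]]_2)
    (p1_gt0 : (0 < p1)%N) (p2_gt0 : (0 < p2)%N) (p1p2 : coprime p1 p2)
    (h_qh : qh_series p1 p2 delta (fps2_of_poly h))
    (h_isolated : isolated_singularity h)
    (mu_gt0 : (0 < mu)%N) (a1 : a (Ordinal mu_gt0) = (0%N, 0%N))
    (a_basis : jacobian_basis (fps2_of_poly h) a)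
    (X_pert : perturbation p1 p2 delta (fps2_of_poly h) X) :
  exists (d : 'I_mu -> nat -> R[i]) (Phi : 'cV[fps2 R[i]]_2),
    [/\ formal_diffeo Phi,
        orbitally_conjugates Phi X
          (hamiltonian delta (fps2_of_poly h) +
           \sum_(i < mu)
             (fps2_comp1 (d i) (fps2_of_poly h) * fps2_mono R[i] (a i)) *:
               euler R[i] p1 p2)
      & exists b : fps2 R[i], is_exp (b *: euler R[i] p1 p2) Phi].
Proof.
have [hx0 hy0 _] := h_isolated.
have a_span f : convergent f -> exists (c : 'I_mu -> R[i]) u v,
    f = \sum_t c t *: fps2_mono R[i] (a t) +
        (u * fps2_deriv 0 (fps2_of_poly h) + v * fps2_deriv 1 (fps2_of_poly h)).
  move=> /a_basis.2 [c [u [v [_ _ uvE]]]]; exists c, u, v.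
  by rewrite -uvE addrC subrK.
apply: (fibered_normal_form p1_gt0 p2_gt0 (qh_series_homog h_qh) a_span _ _ X_pert).
  by rewrite fps2_deriv_poly0 -[RHS]hx0 polyC0 !horner_coef0.
by rewrite fps2_deriv_poly1 -[RHS]hy0 polyC0 !horner_coef0.
Qed.
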